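(* Consider the interval model $Y_t={\bf Z}_t'{\boldsymbol\theta}^0+u_t$, $t=1,\dots,T$, described in the context, with fixed dimension $p$. Suppose: (A1) $\{Y_t,X_{1,t},\dots,X_{J,t}\}$ are strictly stationary and ergodic interval stochastic processes with $\mathbb{E}\|Y_t\|_K^4<\infty$ and $\mathbb{E}\|X_{j,t}\|_K^4<\infty$ for $j=1,\dots,J$; the interval innovation $\{u_t\}$ satisfies $\mathbb{E}(u_t\mid\mathcal{I}_{t-1})=[0,0]$ a.s. (equivalently $\mathbb{E}(s_{u_t}(u)\mid\mathcal I_{t-1})=0$ for $u=\pm1$) and $\mathbb{E}(\|u_t\|_K^2\mid\mathcal{I}_{t-1})=\sigma^2$; (A2) the parameter space $\Theta$ is a compact subset of $\mathbb{R}^p$ and ${\boldsymbol\theta}^0$ is an interior point of $\Theta$; (A3) the matrices $\mathbb{E}[\langle s_{{\bf Z}_t},s'_{{\bf Z}_t}\rangle_K]$ and $\mathbb{E}[\langle s_{{\bf Z}_t},s_{u_t({\boldsymbol\theta})}\rangle_K\langle s_{u_t({\boldsymbol\theta})},s'_{{\bf Z}_t}\rangle_K]$, where $u_t({\boldsymbol\theta})=Y_t-{\bf Z}_t'{\boldsymbol\theta}$, are positive definite for all ${\boldsymbol\theta}$ in a small neighborhood of ${\boldsymbol\theta}^0$; (A4) $\lambda_T/\sqrt{T}\to0$ and $\lambda_T T^{(\gamma-1)/2}\to\infty$ as $T\to\infty$. Then the penalized minimum $D_K$-distance estimator $\hat{\boldsymbol\theta}_T$ satisfies $\|\hat{\boldsymbol\theta}_T-{\boldsymbol\theta}^0\|=O_p(1/\sqrt{T})$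 as $T\to\infty$, where $\|\cdot\|$ is the Euclidean norm.
   Context: Intervals: an (extended) interval is an ordered pair $A=[A_L,A_R]$ of real numbers, where $A_R<A_L$ is allowed. Operations: $A+B=[A_L+B_L,A_R+B_R]$, $A-B=[A_L-B_L,A_R-B_R]$ (Hukuhara difference), $cA=[cA_L,cA_R]$ for $c\in\mathbb{R}$. The support function of $A$ on $S^0=\{-1,1\}$ is $s_A(1)=A_R$, $s_A(-1)=-A_L$. Fix a kernel $K:\{-1,1\}^2\to\mathbb{R}$ that is symmetric positive definite: $K(1,-1)=K(-1,1)$, $K(1,1)>0$, $K(1,1)K(-1,-1)>K(1,-1)^2$. Define $\langle s_A,s_B\rangle_K=\sum_{u,v\in\{-1,1\}}K(u,v)s_A(u)s_B(v)$, $\|A\|_K^2=\langle s_A,s_A\rangle_K$ and the $D_K$-distance $D_K(A,B)=\|A-B\|_K$. For a column vector of intervals ${\bf A}=(A_1,\dots,A_p)'$ and an interval $C$, $\langle s_{\bf A},s'_{\bf A}\rangle_K$ is the $p\times p$ matrix with $(i,j)$ entry $\langle s_{A_i},s_{A_j}\rangle_K$, $\langle s_{\bf A},s_C\rangle_K$ is the $p$-vector with entries $\langle s_{A_i},s_C\rangle_K$, and $\langle s_C,s'_{\bf A}\rangle_K$ is its transpose; for ${\boldsymbol\theta}\in\mathbb{R}^p$, ${\bf A}'{\boldsymbol\theta}=\sum_j\theta_jA_j$. Model (ACIX): $Y_t$ and $X_{1,t},\dots,X_{J,t}$ are interval-valued random variables (time series) on a probability space; $I_0=[-1/2,1/2]$;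 ${\bf X}_t=(X_{1,t},\dots,X_{J,t})'$; ${\bf Z}_t=([1,1],I_0,Y_{t-1},\dots,Y_{t-q},{\bf X}_t',\dots,{\bf X}_{t-s}')'$ is a vector of $p$ intervals; $Y_t={\bf Z}_t'{\boldsymbol\theta}^0+u_t$ with true parameter ${\boldsymbol\theta}^0\in\mathbb{R}^p$ and interval innovation $u_t$; $\mathcal{I}_{t-1}$ denotes the information set at time $t-1$. Estimators: the minimum $D_K$-distance estimator $\tilde{\boldsymbol\theta}_T=(\tilde\theta_1,\dots,\tilde\theta_p)'=\arg\min_{\boldsymbol\theta}\sum_{t=1}^T\|Y_t-{\bf Z}_t'{\boldsymbol\theta}\|_K^2$, and the penalized (interval adaptive LASSO) estimator $\hat{\boldsymbol\theta}_T=\arg\min_{\boldsymbol\theta}\sum_{t=1}^T\|Y_t-{\bf Z}_t'{\boldsymbol\theta}\|_K^2+\lambda_T\sum_{j=1}^p\hat w_j|\theta_j|$ with adaptive weights $\hat w_j=1/|\tilde\theta_j|^\gamma$, tuning parameter $\lambda_T>0$ and a given constant $\gamma>0$. *)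

(* Defs.v *)
From HB Require Import structures.
From mathcomp Require Import all_boot all_order all_algebra.
From mathcomp Require Import all_classical all_reals all_analysis.



Unset Printing Implicit Defensive.

Import Order.TTheory GRing.Theory Num.Theory.
Import numFieldNormedType.Exports.

Local Open Scope classical_set_scope.
Local Open Scope ring_scope.

(** An (extended) interval A = [A_L, A_R] is the pair (A_L, A_R). *)
Definition ivl (R : Type) := (R * R)%type.
Definition iL {R : Type} (A : ivl R) : R := A.1.
Definition iR {R : Type} (A : ivl R) : R := A.2.

(** Hukuhara difference A - B = [A_L - B_L, A_R - B_R]. *)
Definition isub {R : pzRingType} (A B : ivl R) : ivl R :=
  (iL A - iL B, iR A - iR B).

(** Support function on S^0 = {-1,1}; the boolean [true] encodes +1,
    [false] encodes -1:  s_A(1) = A_R, s_A(-1) = - A_L. *)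
Definition supp {R : pzRingType} (A : ivl R) (u : bool) : R :=
  if u then iR A else - iL A.

Definition kern {R : Type} (k11 k12 k22 : R) (u v : bool) : R :=
  if u then (if v then k11 else k12) else (if v then k12 else k22).

Definition ipK {R : pzRingType} (k11 k12 k22 : R) (A B : ivl R) : R :=
  \sum_(u : bool) \sum_(v : bool) kern k11 k12 k22 u v * supp A u * supp B v.

Definition normK {R : rcfType} (k11 k12 k22 : R) (A : ivl R) : R :=
  Num.sqrt (ipK k11 k12 k22 A A).

Definition dimp (q s J : nat) : nat := (2 + q + J * s.+1)%N.

(** The regressor vector Z_t = ([1,1], I_0, Y_{t-1},...,Y_{t-q}, X_t',...,X_{t-s}')',
    as a sequence of intervals (of length dimp q s J), given the
    realized paths of Y and X_1..X_J. *)
Definition Zseq {R : fieldType} (q s J : nat) (Y : int -> ivl R)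
    (X : 'I_J -> int -> ivl R) (t : int) : seq (ivl R) :=
  [:: (1, 1); (- (1 / 2), 1 / 2)]
  ++ [seq Y (t - (i.+1)%:Z) | i <- iota 0 q]
  ++ flatten [seq [seq X j (t - i%:Z) | j <- enum 'I_J] | i <- iota 0 s.+1].

Definition Zlin {R : fieldType} (q s J : nat) (Y : int -> ivl R)
    (X : 'I_J -> int -> ivl R) (t : int) (th : 'cV[R]_(dimp q s J))
    : ivl R :=
  (\sum_(j < dimp q s J) th j 0 * iL (nth (0, 0) (Zseq q s J Y X t) j),
   \sum_(j < dimp q s J) th j 0 * iR (nth (0, 0) (Zseq q s J Y X t) j)).

Definition Zcomp {R : fieldType} (q s J : nat) (Y : int -> ivl R)
    (X : 'I_J -> int -> ivl R) (t : int) (j : 'I_(dimp q s J))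
    : ivl R := nth (0, 0) (Zseq q s J Y X t) j.

Definition resid {R : fieldType} (q s J : nat) (Y : int -> ivl R)
    (X : 'I_J -> int -> ivl R) (t : int) (th : 'cV[R]_(dimp q s J))
    : ivl R := isub (Y t) (Zlin q s J Y X t th).

Definition QK {R : rcfType} (k11 k12 k22 : R) (q s J : nat)
    (Y : int -> ivl R) (X : 'I_J -> int -> ivl R) (n : nat)
    (th : 'cV[R]_(dimp q s J)) : R :=
  \sum_(1 <= t < n.+1) normK k11 k12 k22 (resid q s J Y X t%:Z th) ^+ 2.

(** Adaptive-lasso penalty term  w_j |theta_j|  with w_j = 1/|tilde theta_j|^gamma,
    in the extended reals, with the usual conventions 1/0 = +oo, +oo * 0 = 0. *)
Definition alpen {R : realType} (gam : R) (tl th : R) : \bar R :=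
  if tl == 0 then (if th == 0 then 0%E else +oo%E)
  else (`|th| / (`|tl| `^ gam))%:E.

Definition QKpen {R : realType} (k11 k12 k22 : R) (q s J : nat)
    (Y : int -> ivl R) (X : 'I_J -> int -> ivl R) (n : nat)
    (lam gam : R) (tl th : 'cV[R]_(dimp q s J)) : \bar R :=
  ((QK k11 k12 k22 q s J Y X n th)%:E
   + lam%:E * \sum_(j < dimp q s J) alpen gam (tl j ord0) (th j ord0))%E.

Definition enorm {R : rcfType} {p : nat} (x : 'cV[R]_p) : R :=
  Num.sqrt (\sum_(i < p) x i 0 ^+ 2).

Definition posdef {R : realFieldType} {p : nat} (M : 'M[R]_p) : Prop :=
  forall x : 'cV[R]_p, x != 0 -> 0 < (x^T *m M *m x) 0 0.

Definition Ex {R : realType} {d} {Om : measurableType d}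
    (P : probability Om R) (f : Om -> R) : R :=
  fine (\int[P]_w (f w)%:E)%E.

Definition cidx (J : nat) := (bool + 'I_J * bool)%type.

Definition pcoord {R Om : Type} {J : nat} (Y : int -> Om -> ivl R)
    (X : 'I_J -> int -> Om -> ivl R) (k : cidx J) (t : int) (w : Om) : R :=
  match k with
  | inl b => if b then iR (Y t w) else iL (Y t w)
  | inr (j, b) => if b then iR (X j t w) else iL (X j t w)
  end.

(** Strict stationarity: all finite-dimensional distributions are
    shift invariant (stated on products of Borel sets, which determine
    the finite-dimensional laws). *)
Definition strictly_stationary {R : realType} {d} {Om : measurableType d}
    (P : probability Om R) {I : Type} (c : I -> int -> Om -> R) : Prop :=
  forall (n : nat) (ts : 'I_n -> int) (ks : 'I_n -> I) (Bs : 'I_n -> set R),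
    (forall i, measurable (Bs i)) ->
    forall h : int,
      P [set w | forall i, Bs i (c (ks i) (ts i + h) w)]
      = P [set w | forall i, Bs i (c (ks i) (ts i) w)].

Definition cylinders {R : realType} {I : Type} : set (set (int -> I -> R)) :=
  [set C | exists (t : int) (k : I) (B : set R),
      measurable B /\ C = [set f | B (f t k)]].

Definition pshift {R : Type} {I : Type} (f : int -> I -> R) : int -> I -> R :=
  fun t k => f (t + 1) k.

Definition ergodic {R : realType} {d} {Om : measurableType d}
    (P : probability Om R) {I : Type} (c : I -> int -> Om -> R) : Prop :=
  forall S : set (int -> I -> R),
    <<s (@cylinders R I) >> S ->
    pshift @^-1` S = S ->
    P [set w | S (fun t k => c k t w)] = 0%E \/
    P [set w | S (fun t k => c k t w)] = 1%E.

(** Information set I_{t-1}: the sigma-algebra generated by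
    Y_{t-1}, Y_{t-2}, ... and X_t, X_{t-1}, ... (so that Z_t is
    I_{t-1}-measurable). *)
Definition info_prev {R : realType} {Om : Type} {J : nat}
    (Y : int -> Om -> ivl R) (X : 'I_J -> int -> Om -> ivl R)
    (t : int) : set (set Om) :=
  <<s [set A | exists (k : cidx J) (r : int) (B : set R),
        measurable B /\
        (match k with inl _ => r < t | inr _ => r <= t end)%R /\
        A = (pcoord Y X k r) @^-1` B] >>.

Definition Zc {R : fieldType} {Om : Type} (q s J : nat) (Y : int -> Om -> ivl R)
    (X : 'I_J -> int -> Om -> ivl R) (t : int) (j : 'I_(dimp q s J))
    (w : Om) : ivl R :=
  Zcomp q s J (fun r => Y r w) (fun i r => X i r w) t j.

Definition ut {R : fieldType} {Om : Type} (q s J : nat) (Y : int -> Om -> ivl R)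
    (X : 'I_J -> int -> Om -> ivl R) (t : int) (th : 'cV[R]_(dimp q s J))
    (w : Om) : ivl R :=
  resid q s J (fun r => Y r w) (fun i r => X i r w) t th.

Definition Qn {R : rcfType} {Om : Type} (k11 k12 k22 : R) (q s J : nat)
    (Y : int -> Om -> ivl R) (X : 'I_J -> int -> Om -> ivl R)
    (n : nat) (w : Om) (th : 'cV[R]_(dimp q s J)) : R :=
  QK k11 k12 k22 q s J (fun r => Y r w) (fun i r => X i r w) n th.

Definition Qnpen {R : realType} {Om : Type} (k11 k12 k22 : R) (q s J : nat)
    (Y : int -> Om -> ivl R) (X : 'I_J -> int -> Om -> ivl R)
    (n : nat) (lam gam : R) (w : Om) (tl th : 'cV[R]_(dimp q s J)) : \bar R :=
  QKpen k11 k12 k22 q s J (fun r => Y r w) (fun i r => X i r w) n lam gam tl th.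

(* Main.v *)
Require Import Defs.
From HB Require Import structures.
From mathcomp Require Import all_boot all_order all_algebra.
From mathcomp Require Import all_classical all_reals all_analysis.
From mathcomp Require Import measurable_realfun ring lra.
Import Order.TTheory GRing.Theory Num.Theory.
Import numFieldNormedType.Exports.
Local Open Scope classical_set_scope.
Local Open Scope ring_scope.

(* Minimality of the penalized criterion at the true parameter gives, for
   h = theta_hat - theta0, the basic inequality
     h' M_n h <= 2 h' S_n + lambda_n * sum_j w_j |h_j|,
   with M_n = sum_t <Z_t, Z_t'>, S_n = sum_t <Z_t, u_t> and j ranging over the support
   of theta0.  The ergodic theorem gives M_n >= n c with high probability, orthogonality
   of martingale differences gives S_n = O_p(sqrt n), and the same inequality with
   lambda_n = 0 shows that the unpenalized estimator is close to theta0, so the weights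
   on the support are bounded; finally lambda_n = O(sqrt n).

   The form of the ergodic theorem that is needed (if E f < 0, then the orbit sums of f
   are almost surely bounded above) follows from the recursion
     M_0 = f,  M_(n+1) = f + max(0, M_n o tau)
   for the maximal orbit sums: the set where they are unbounded is invariant, and if it
   had full measure, then 0 <= E (M_(n+1) - M_n o tau) --> E f < 0. *)

Set Implicit Arguments.
Unset Strict Implicit.

(** * Integrability of products *)

Definition L1 {d} {T : measurableType d} {R : realType}
    (mu : {measure set T -> \bar R}) (f : T -> R) : Prop :=
  mu.-integrable setT (EFin \o f).

Definition L2 {d} {T : measurableType d} {R : realType}
    (mu : {measure set T -> \bar R}) (f : T -> R) : Prop :=
  measurable_fun setT f /\ L1 mu (fun x => f x ^+ 2).

(** Fourth moments are expressed as second moments of the square, so each closure property of [L4]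
    reduces to the one for [L2]. *)
Definition L4 {d} {T : measurableType d} {R : realType}
    (mu : {measure set T -> \bar R}) (f : T -> R) : Prop :=
  measurable_fun setT f /\ L2 mu (fun x => f x ^+ 2).

Section integrability.
Context {d} {T : measurableType d} {R : realType}.
Variable mu : {measure set T -> \bar R}.
Implicit Types f g : T -> R.

Lemma L1_measurable f : L1 mu f -> measurable_fun setT f.
Proof. by move=> /measurable_int /measurable_EFinP. Qed.

Lemma L1_dom f g : measurable_fun setT f -> L1 mu g ->
  (forall x, `|f x| <= g x) -> L1 mu f.
Proof.
move=> mf ig fg; apply: le_integrable ig => //; first exact/measurable_EFinP.
by move=> x _ /=; rewrite lee_fin (le_trans (fg x))// ler_norm.
Qed.

Lemma L1_ge0 f : measurable_fun setT f -> (forall x, 0 <= f x) ->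
  (\int[mu]_x (f x)%:E < +oo)%E -> L1 mu f.
Proof.
move=> mf f0 fi; apply/integrableP; split; first exact/measurable_EFinP.
by under eq_integral => x _ do rewrite /= ger0_norm//.
Qed.

Lemma L1D f g : L1 mu f -> L1 mu g -> L1 mu (fun x => f x + g x).
Proof. by move=> fi gi; apply: (integrableD measurableT fi gi). Qed.

Lemma L1Z k f : L1 mu f -> L1 mu (fun x => k * f x).
Proof. exact: (integrableZl measurableT). Qed.

Lemma L1B f g : L1 mu f -> L1 mu g -> L1 mu (fun x => f x - g x).
Proof. by move=> fi gi; apply: (integrableB measurableT fi gi). Qed.

(** The product is dominated by [f x ^+ 2 + g x ^+ 2]. *)
Lemma L2M f g : L2 mu f -> L2 mu g -> L1 mu (fun x => f x * g x).
Proof.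
move=> [mf fi] [mg gi]; apply: (L1_dom _ (L1D fi gi)).
  exact: measurable_funM.
move=> x /=; rewrite ler_norml; apply/andP; split; nra.
Qed.

Lemma L2D f g : L2 mu f -> L2 mu g -> L2 mu (fun x => f x + g x).
Proof.
move=> fi gi; have fgi := L2M fi gi; case: fi gi => [mf fi] [mg gi].
split; first exact: measurable_funD.
have := L1D (L1D fi gi) (L1Z 2 fgi); congr L1; apply/funext => x; ring.
Qed.

Lemma L2Z k f : L2 mu f -> L2 mu (fun x => k * f x).
Proof.
move=> [mf fi]; split; first exact: measurable_funM.
by have := L1Z (k ^+ 2) fi; congr L1; apply/funext => x; ring.
Qed.

Lemma L2_sum (I : Type) (r : seq I) (F : I -> T -> R) :
  (forall i, L2 mu (F i)) -> L2 mu (fun x => \sum_(i <- r) F i x).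
Proof.
move=> Fi; elim: r => [|i r IH].
  split; first by under eq_fun do rewrite big_nil; exact: measurable_cst.
  under eq_fun do rewrite big_nil expr0n/=; exact: integrable0.
by under eq_fun do rewrite big_cons; exact: L2D.
Qed.

Lemma L4M f g : L4 mu f -> L4 mu g -> L2 mu (fun x => f x * g x).
Proof.
move=> [mf fi] [mg gi]; split; first exact: measurable_funM.
by have := L2M fi gi; congr L1; apply/funext => x; ring.
Qed.

Lemma L4D f g : L4 mu f -> L4 mu g -> L4 mu (fun x => f x + g x).
Proof.
move=> fi gi; have fgi := L4M fi gi; case: fi gi => [mf fi] [mg gi].
split; first exact: measurable_funD.
have := L2D (L2D fi gi) (L2Z 2 fgi); congr L2; apply/funext => x; ring.
Qed.

Lemma L4Z k f : L4 mu f -> L4 mu (fun x => k * f x).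
Proof.
move=> [mf fi]; split; first exact: measurable_funM.
by have := L2Z (k ^+ 2) fi; congr L2; apply/funext => x; ring.
Qed.

Lemma L1_cst k : (mu setT < +oo)%E -> L1 mu (cst k).
Proof.
move=> mu_fin; apply/integrableP; split; first exact: (measurable_cst k%:E).
by rewrite (integral_cst mu measurableT `|k|%:E) lte_mul_pinfty ?lee_fin.
Qed.

Lemma L4_cst k : (mu setT < +oo)%E -> L4 mu (cst k).
Proof.
move=> mu_fin; split; first exact: measurable_cst.
split; first exact: (measurable_cst (k ^+ 2)).
exact: (L1_cst ((k ^+ 2) ^+ 2)).
Qed.

Lemma L2_L1 f : (mu setT < +oo)%E -> L2 mu f -> L1 mu f.
Proof.
move=> mu_fin fi; have c : L2 mu (cst 1).
  split; first exact: measurable_cst.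
  exact: (L1_cst (1 ^+ 2)).
by have := L2M fi c; congr L1; apply/funext => x; rewrite /cst mulr1.
Qed.

Lemma L4_L2 f : (mu setT < +oo)%E -> L4 mu f -> L2 mu f.
Proof. by move=> mu_fin [mf fi]; split => //; exact: L2_L1. Qed.

Lemma L1_max0 f : L1 mu f -> L1 mu (fun x => Num.max 0 (f x)).
Proof.
move=> fi; apply: (L1_dom _ (integrable_norm fi)).
  by apply: measurable_maxr => //; exact: L1_measurable.
move=> x; rewrite /= ger0_norm ?le_max ?lexx// ge_max normr_ge0.
exact: ler_norm.
Qed.

Lemma Chebyshev f c : L2 mu f -> 0 < c ->
  ((c ^+ 2)%:E * mu [set x | (c < `|f x|)%R]
    <= (\int[mu]_x f x ^+ 2)%R%:E)%E.
Proof.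
move=> [mf fi] c0.
have mA : measurable [set x | c < `|f x|].
  rewrite -[X in measurable X]setTI; apply: measurable_fun_ltr => //.
  exact: measurableT_comp.
rewrite /Rintegral fineK; last exact: (integrable_fin_num measurableT fi).
apply: (@le_trans _ _ (\int[mu]_(x in [set x | (c < `|f x|)%R]) (f x ^+ 2)%:E)%E).
  rewrite -integral_cst//; apply: ge0_le_integral => //.
  - by move=> x _; rewrite lee_fin sqr_ge0.
  - apply/measurable_EFinP; apply: measurable_funTS; exact: (L1_measurable fi).
  move=> x /= cfx; rewrite lee_fin -[leRHS]real_normK ?num_real//.
  by rewrite ler_sqr ?nnegrE ?normr_ge0 ?ltW.
apply: ge0_subset_integral => //.
  apply/measurable_EFinP; exact: (L1_measurable fi).
by move=> x _; rewrite lee_fin sqr_ge0.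
Qed.
End integrability.

(** * The ergodic theorem *)

Section maximal_sums.
Context {d} {T : measurableType d} {R : realType}.
Variables (mu : {measure set T -> \bar R}) (tau : T -> T).
Hypothesis mtau : measurable_fun setT tau.
Hypothesis tau_mu : forall A, measurable A -> mu (tau @^-1` A) = mu A.

(** This is the largest of the sums of [f] over the first k points of the orbit of [x], for k from 1
    to [n.+1]. The recursion splits off the first point. *)
Fixpoint maxsum (f : T -> R) (n : nat) (x : T) : R :=
  if n is m.+1 then f x + Num.max 0 (maxsum f m (tau x)) else f x.

Lemma maxsum_nd f n x : maxsum f n x <= maxsum f n.+1 x.
Proof.
elim: n x => [|n IH] x; first by rewrite /= lerDl le_max lexx.
rewrite [leLHS]/= [leRHS]/= lerD2l ge_max !le_max lexx/=.
by rewrite IH orbT.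
Qed.

Lemma maxsum_homo f x : {homo maxsum f ^~ x : m n / (m <= n)%N >-> m <= n}.
Proof. by apply: homo_leq => // [y|n]; [exact: le_trans|exact: maxsum_nd]. Qed.

Lemma sum_le_maxsum f n x :
  \sum_(i < n.+1) f (iter i tau x) <= maxsum f n x.
Proof.
elim: n x => [|n IH] x; first by rewrite big_ord_recl big_ord0 addr0.
rewrite big_ord_recl lerD2l le_max; apply/orP; right.
by apply: le_trans (IH (tau x)); under eq_bigr do rewrite /= -iterS iterSr.
Qed.

Lemma L1_tau f : L1 mu f -> L1 mu (f \o tau).
Proof.
move=> fi; apply/integrableP; split.
  by apply/measurable_EFinP; apply: measurableT_comp => //; exact: L1_measurable fi.
have mf : measurable_fun setT (fun x => `|(f x)%:E|%E).
  apply: measurableT_comp => //; apply/measurable_EFinP; exact: L1_measurable fi.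
have := ge0_integral_pushforward mtau mu measurableT mf (fun x _ => abse_ge0 _).
rewrite preimage_setT => <-.
rewrite (eq_measure_integral mu) => [|A mA _]; last exact: tau_mu.
by case/integrableP : fi.
Qed.

Lemma Rintegral_tau f : L1 mu f ->
  \int[mu]_x f (tau x) = \int[mu]_x f x.
Proof.
move=> fi; rewrite /Rintegral; congr fine.
have mf : measurable_fun setT (EFin \o f).
  by apply/measurable_EFinP; exact: L1_measurable fi.
have := integral_pushforward mtau mf _ measurableT.
rewrite preimage_setT => <-; last exact: L1_tau.
by rewrite (eq_measure_integral (pushforward mu tau)) => [//|A mA _]; rewrite -tau_mu.
Qed.

Lemma Rintegral_iter f n : L1 mu f ->
  \int[mu]_x f (iter n tau x) = \int[mu]_x f x.
Proof.
elim: n f => [//|n IH] f fi; rewrite -(Rintegral_tau fi) -(IH _ (L1_tau fi)).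
by apply: eq_Rintegral => x _; rewrite iterS.
Qed.

Lemma L1_maxsum f n : L1 mu f -> L1 mu (maxsum f n).
Proof.
move=> fi; elim: n => [//|n IH].
by apply: L1D => //; apply: L1_max0; exact: L1_tau.
Qed.

Definition maxsum_unbounded f : set T :=
  \bigcap_m \bigcup_n [set x | (m%:R < maxsum f n x)%R].

Lemma measurable_maxsum_gt f n (c : R) : L1 mu f ->
  measurable [set x | c < maxsum f n x].
Proof.
move=> fi; rewrite -[X in measurable X]setTI; apply: measurable_fun_ltr => //.
exact: L1_measurable (L1_maxsum n fi).
Qed.

Lemma measurable_maxsum_unbounded f : L1 mu f -> measurable (maxsum_unbounded f).
Proof.
move=> fi; apply: bigcapT_measurable => m; apply: bigcupT_measurable => n.
exact: measurable_maxsum_gt.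
Qed.

(** By the recursion, the maximum at [x] and the positive part of the maximum at [tau x] differ by
    [f x], which does not depend on the length. Raising the level by a bound of [f x] absorbs this
    difference. *)
Lemma maxsum_unbounded_invariant f :
  tau @^-1` maxsum_unbounded f = maxsum_unbounded f.
Proof.
apply/seteqP; split=> x /= ux m _;
  have [n _ /= nx] := ux (m + Num.bound `|f x|)%N I;
  have := archi_boundP (normr_ge0 (f x)); move: nx; rewrite natrD.
- move=> nx bx; exists n.+1 => //=.
  have := ler_norm (- f x); rewrite normrN => fx.
  apply: (@lt_le_trans _ _ (f x + maxsum f n (tau x))); first lra.
  by rewrite lerD2l le_max lexx orbT.
- move=> nx bx; exists n => //=.
  have := maxsum_nd f n x; rewrite [leRHS]/= => ndx.
  have fx := ler_norm (f x).
  have : m%:R < Num.max 0 (maxsum f n (tau x)) by lra.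
  by rewrite lt_max ltNge ler0n.
Qed.

(* If the maxima were almost surely unbounded, then [maxsum f n.+1 - maxsum f n \o tau]
   would converge to [f], whereas its integral is nonnegative. *)
Lemma maxsum_unbounded_ge0 f : L1 mu f -> mu (~` maxsum_unbounded f) = 0%E ->
  0 <= \int[mu]_x f x.
Proof.
move=> fi A0.
pose g n x := maxsum f n.+1 x - maxsum f n (tau x).
have gi n : L1 mu (g n).
  by apply: L1B; [exact: L1_maxsum|apply: L1_tau; exact: L1_maxsum].
have gE n x : g n x = f x + (Num.max 0 (maxsum f n (tau x)) - maxsum f n (tau x)).
  by rewrite /g /= addrA.
(* By invariance [tau x] also has unbounded maxima. They are eventually nonnegative, and from then
   on [g n x] equals [f x]. *)
have cvg_g : {ae mu, forall x, setT x -> (g n x)%:E @[n --> \oo] --> (f x)%:E}.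
  exists (~` maxsum_unbounded f); split => //.
    by apply: measurableC; exact: measurable_maxsum_unbounded.
  move=> x /= ncv; apply: contra_not ncv.
  rewrite -maxsum_unbounded_invariant => /= ux _.
  apply: cvg_near_cst; have [n _ /= nx] := ux 0%N I.
  near=> k; rewrite gE.
  have kx : 0 <= maxsum f k (tau x).
    apply: le_trans (ltW nx) _; apply: maxsum_homo.
    near: k; exact: nbhs_infty_ge.
  by rewrite (max_idPr kx) subrr addr0.
have hi : L1 mu (fun x => `|f x| + `|f (tau x)|).
  by apply: L1D; [exact: integrable_norm|exact: integrable_norm (L1_tau fi)].
(* The difference between [g n x] and [f x] is the negative part of [maxsum f n (tau x)]. That
   maximum is at least its first term [f (tau x)]. *)
have dom : {ae mu, forall x n, setT x -> (`|(g n x)%:E| <= (`|f x| + `|f (tau x)|)%:E)%E}.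
  apply: aeW => x n _; rewrite abse_EFin lee_fin gE (le_trans (ler_normD _ _))//.
  rewrite lerD2l.
  have Mf : f (tau x) <= maxsum f n (tau x) by exact: (maxsum_homo f _ (leq0n n)).
  have := ler_norm (- f (tau x)); rewrite normrN => fx.
  have := normr_ge0 (f (tau x)) => nx.
  rewrite ger0_norm ?subr_ge0 ?le_max ?lexx ?orbT//.
  by rewrite lerBlDr ge_max; apply/andP; split; lra.
have mEF h : L1 mu h -> measurable_fun setT (fun x => (h x)%:E).
  by move=> hi'; exact: measurable_int hi'.
have [_ _ cvgI] := dominated_convergence measurableT (fun n => mEF _ (gi n))
  (mEF _ fi) cvg_g hi dom.
(* Invariance of [mu] removes [tau] under the integral, and the maxima increase with [n]. *)
have g0 n : (0 <= \int[mu]_x (g n x)%:E)%E.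
  rewrite -(fineK (integrable_fin_num measurableT (gi n))) lee_fin.
  have := RintegralB measurableT (L1_maxsum n.+1 fi) (L1_tau (L1_maxsum n fi)).
  rewrite /Rintegral/= => ->.
  have := Rintegral_tau (L1_maxsum n fi); rewrite /Rintegral => ->.
  rewrite subr_ge0; apply: le_Rintegral => //.
  - exact: L1_maxsum.
  - exact: (L1_maxsum n.+1).
  - by move=> x _; exact: maxsum_nd.
rewrite -lee_fin /Rintegral fineK; last exact: (integrable_fin_num measurableT fi).
apply: (closed_cvg _ (@closed_ereal_le_ereal R 0%E) _ _ cvgI) => //.
by apply: nearW => n; exact: g0.
Unshelve. all: by end_near. Qed.

Hypothesis tau_ergodic : forall A, measurable A -> tau @^-1` A = A ->
  mu A = 0%E \/ mu (~` A) = 0%E.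
Hypothesis mu1 : mu setT = 1%E.

Let mu_fin : (mu setT < +oo)%E.
Proof. by rewrite mu1 ltry. Qed.

(** By ergodicity the invariant set of unbounded maxima is null, since full measure would force a
    nonnegative mean. It is a decreasing intersection over the level, so continuity from above
    supplies [m]. *)
Lemma maxsum_bounded f e : L1 mu f -> \int[mu]_x f x < 0 -> 0 < e ->
  exists m : nat, (mu (\bigcup_n [set x | (m%:R < maxsum f n x)%R]) < e%:E)%E.
Proof.
move=> fi f0 e0.
have A0 : mu (maxsum_unbounded f) = 0%E.
  have [//|/(maxsum_unbounded_ge0 fi)] := tau_ergodic
    (measurable_maxsum_unbounded fi) (maxsum_unbounded_invariant f).
  by rewrite leNgt f0.
pose F m := \bigcup_n [set x | (m%:R < maxsum f n x)%R].
have mF m : measurable (F m).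
  by apply: bigcupT_measurable => n; exact: measurable_maxsum_gt.
have : (mu \o F) x @[x --> \oo] --> mu (\bigcap_n F n).
  apply: nonincreasing_cvg_mu => //.
  - by rewrite (le_lt_trans _ mu_fin)// le_measure ?inE.
  - exact: bigcapT_measurable.
  - move=> a b ab; apply/subsetPset => x [n _ /= nx]; exists n => //=.
    by apply: le_lt_trans nx; rewrite ler_nat.
rewrite -/(maxsum_unbounded f) A0 => /(_ [set y | (y < e%:E)%E]) [|m _ me].
  by apply: open_nbhs_nbhs; split; [exact: (@open_ereal_lt_ereal R)|rewrite /= lte_fin].
by exists m; exact: (me m (leqnn m)).
Qed.

Lemma measurable_iter n : measurable_fun setT (iter n tau).
Proof.
elim: n => [|n IH]; first exact: measurable_id.
exact: measurableT_comp mtau IH.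
Qed.

Lemma measurable_orbit_sum f n : L1 mu f ->
  measurable_fun setT (fun x => \sum_(i < n) f (iter i tau x)).
Proof.
move=> fi; apply: measurable_sum => i.
by apply: measurableT_comp (measurable_iter i); exact: L1_measurable fi.
Qed.

(** Centre [f] at the midpoint [b] of its mean and [a]. The orbit sums of [f - b] stay below a
    constant off a small set, and the linear gain [n%:R * (a - b)] eventually exceeds that
    constant. *)
Lemma orbit_sum_upper f a e : L1 mu f -> \int[mu]_x f x < a -> 0 < e ->
  exists N, forall n, (N <= n)%N ->
    (mu [set x | (n%:R * a < \sum_(i < n) f (iter i tau x))%R] < e%:E)%E.
Proof.
move=> fi fa e0; pose b := ((\int[mu]_x f x) + a) / 2.
have bi := L1_cst b mu_fin.
have [|m me] := maxsum_bounded (L1B fi bi) _ e0.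
  rewrite (RintegralB measurableT fi bi) (Rintegral_cst mu measurableT).
  rewrite [mu _]mu1 /b /=; lra.
have ab : 0 < a - b by rewrite /b; lra.
(* The successor rules out an empty sum: [maxsum _ n] controls the sum of [n.+1] terms. *)
exists (Num.bound (m%:R / (a - b))).+1 => -[//|n nN].
apply: le_lt_trans me; apply: le_measure; rewrite ?inE.
- rewrite -[X in measurable X]setTI; apply: measurable_fun_ltr => //.
  exact: measurable_orbit_sum.
- apply: bigcupT_measurable => k; apply: measurable_maxsum_gt.
  exact: L1B.
move=> x /= nx; exists n => //=.
apply: (@lt_le_trans _ _ (\sum_(i < n.+1) (f (iter i tau x) - b))); last first.
  exact: (sum_le_maxsum (fun x => f x - b)).
rewrite sumrB sumr_const card_ord -[b *+ _]mulr_natl.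
have nm : m%:R < n%:R * (a - b).
  rewrite -ltr_pdivrMr//; apply: lt_le_trans (archi_boundP _) _.
    by rewrite divr_ge0 ?ler0n// ltW.
  by rewrite ler_nat.
rewrite -natr1 in nx *; nra.
Qed.

(** The one-sided bound is applied to [f] and to [- f], each with half of the tolerance. *)
Lemma orbit_sum_lln f dl e : L1 mu f -> 0 < dl -> 0 < e ->
  exists N, forall n, (N <= n)%N ->
    (mu [set x | (n%:R * dl < `|\sum_(i < n) f (iter i tau x)
                               - n%:R * \int[mu]_y f y|)%R] < e%:E)%E.
Proof.
move=> fi dl0 e0; have e20 : 0 < e / 2 by rewrite divr_gt0.
have [|N1 HN1] := @orbit_sum_upper _ ((\int[mu]_x f x) + dl) _ fi _ e20.
  by rewrite ltrDl.
have nfi := L1Z (-1) fi.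
have [|N2 HN2] := @orbit_sum_upper _ (- (\int[mu]_x f x) + dl) _ nfi _ e20.
  by rewrite (RintegralZl (-1) measurableT fi) mulN1r ltrDl.
exists (maxn N1 N2) => n; rewrite geq_max => /andP[/HN1 n1 /HN2 n2].
rewrite (splitr e) EFinD; apply: le_lt_trans (lteD n1 n2).
have mset g c : L1 mu g ->
    measurable [set x | c < \sum_(i < n) g (iter i tau x)].
  move=> gi; rewrite -[X in measurable X]setTI; apply: measurable_fun_ltr => //.
  exact: measurable_orbit_sum.
apply: (le_trans _ (measureU2 mu (mset _ _ fi) (mset _ _ nfi))).
apply: le_measure; rewrite ?inE.
- rewrite -[X in measurable X]setTI; apply: measurable_fun_ltr => //.
  apply: measurableT_comp => //; apply: measurable_funB => //.
  exact: measurable_orbit_sum.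
- exact: (measurableU _ _ (mset _ _ fi) (mset _ _ nfi)).
move=> x /=; rewrite ltr_normr => /orP[] h; [left|right].
  by rewrite mulrDr; lra.
under eq_bigr do rewrite mulN1r.
by rewrite sumrN mulrDr mulrN; lra.
Qed.

End maximal_sums.

(** * Stationary processes on path space *)

Notation pathT R I := (g_sigma_algebraType (@cylinders R I)).

Section path_space.
Context {R : realType} {I : Type}.

Lemma measurable_coord (t : int) (k : I) :
  measurable_fun setT (fun f : pathT R I => f t k).
Proof.
move=> _ B mB; rewrite setTI; apply: sub_sigma_algebra.
by exists t, k, B.
Qed.

Lemma measurable_to_path {d} {Om : measurableType d} (g : Om -> pathT R I) :
  (forall t k, measurable_fun setT (fun w => g w t k)) ->
  measurable_fun setT g.
Proof.
move=> mg; apply: (@measurability _ _ _ (pathT R I) _ _ (@cylinders R I) erefl).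
move=> _ [_ [t [k [B [mB ->]]]] <-].
exact: mg.
Qed.

Lemma measurable_pshift :
  measurable_fun setT (pshift : pathT R I -> pathT R I).
Proof. apply: measurable_to_path => t k; exact: measurable_coord. Qed.

(** These are the sets on which [strictly_stationary] compares probabilities. Unlike [cylinders],
    they are closed under intersection. *)
Definition box_cylinders : set (set (pathT R I)) :=
  [set C | exists n (ts : 'I_n -> int) (ks : 'I_n -> I) (Bs : 'I_n -> set R),
    (forall i, measurable (Bs i)) /\ C = [set f | forall i, Bs i (f (ts i) (ks i))]].

Lemma box_cylinders_setI : setI_closed box_cylinders.
Proof.
move=> _ _ [n1 [t1 [k1 [B1 [m1 ->]]]]] [n2 [t2 [k2 [B2 [m2 ->]]]]].
pose glue (U : Type) (a : 'I_n1 -> U) (b : 'I_n2 -> U) (i : 'I_(n1 + n2)) :=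
  match fintype.split i with inl j => a j | inr j => b j end.
exists (n1 + n2)%N, (glue _ t1 t2), (glue _ k1 k2), (glue _ B1 B2); split.
  by move=> i; rewrite /glue; case: (fintype.split i).
apply/seteqP; split => f /=.
  by move=> [f1 f2] i; rewrite /glue; case: (fintype.split i).
move=> fi; split=> i.
  by have := fi (unsplit (inl i)); rewrite /glue unsplitK.
by have := fi (unsplit (inr i)); rewrite /glue unsplitK.
Qed.

Lemma box_cylinders_measurable : box_cylinders `<=` measurable.
Proof.
move=> _ [n [ts [ks [Bs [mB ->]]]]].
rewrite (_ : [set f | _] =
    \bigcap_(i in setT) [set f : pathT R I | Bs i (f (ts i) (ks i))]).
  apply: fin_bigcap_measurable => [|i _]; first exact: finite_finset.
  rewrite -[X in measurable X]setTI; exact: measurable_coord.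
by apply/seteqP; split => f /= fi i => [_|]; exact: fi.
Qed.

Lemma cylinders_sub_box : @cylinders R I `<=` box_cylinders.
Proof.
move=> _ [t [k [B [mB ->]]]].
exists 1%N, (fun=> t), (fun=> k), (fun=> B); split => //.
by apply/seteqP; split => f /= fB => [_ //|]; exact: (fB ord0).
Qed.

End path_space.

(** * The law of a process and its invariance under the shift *)

Section stationary_process.
Context {R : realType} {d} {Om : measurableType d} (P : probability Om R).
Context {I : Type} (c : I -> int -> Om -> R).
Hypothesis mc : forall k t, measurable_fun setT (c k t).

Definition path_of (w : Om) : pathT R I := fun t k => c k t w.

Lemma measurable_path_of : measurable_fun setT path_of.
Proof. by apply: measurable_to_path => t k; exact: mc. Qed.

Definition law : {measure set (pathT R I) -> \bar R}.
Proof.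
refine [the {measure set (pathT R I) -> \bar R} of pushforward P path_of].
exact: measurable_path_of.
Defined.

Lemma lawE S : law S = P (path_of @^-1` S).
Proof. by []. Qed.

Lemma law_setT : law setT = 1%E.
Proof. by rewrite lawE preimage_setT probability_setT. Qed.

(** The law and its image under the shift are finite measures that agree on the boxes, an
    intersection-stable family generating the sigma-algebra, so they coincide. *)
Lemma stationary_pshift (S : set (pathT R I)) : strictly_stationary P c ->
  measurable S -> law (pshift @^-1` S) = law S.
Proof.
move=> st mS.
have law' : {nu : {measure set (pathT R I) -> \bar R} |
    forall A, nu A = law (pshift @^-1` A)}.
  unshelve eexists.
    refine [the {measure set (pathT R I) -> \bar R} of
      pushforward law (pshift : pathT R I -> pathT R I)].
    exact: measurable_pshift.
  by [].
case: law' => nu nuE; rewrite -nuE.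
apply: (@g_sigma_algebra_measure_unique _ _ _ _ box_cylinders_measurable (fun=> setT)).
(* The whole space is the box without constraints. *)
- move=> _; exists 0%N, (fun=> 0), (fun i : 'I_0 => False_rect _ (notF (ltn_ord i))),
    (fun=> setT); split=> [[]//|].
  by apply/seteqP; split => f // _ [].
- exact: bigcup_const.
- exact: box_cylinders_setI.
- move=> _ [n [ts [ks [Bs [mB ->]]]]]; rewrite nuE !lawE.
  exact: (st n ts ks Bs mB 1).
- by move=> _; rewrite nuE lawE !preimage_setT probability_setT ltry.
- move: S mS; apply: sub_sigma_algebra2; exact: cylinders_sub_box.
Qed.

Lemma ergodic_pshift (S : set (pathT R I)) : ergodic P c ->
  measurable S -> pshift @^-1` S = S -> law S = 0%E \/ law (~` S) = 0%E.
Proof.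
move=> er mS iS; have mP : measurable (path_of @^-1` S).
  by rewrite -[X in measurable X]setTI; exact: measurable_path_of.
rewrite !lawE preimage_setC probability_setC//.
have [->|->] := er S mS iS; [by left|right].
by rewrite subee.
Qed.

Lemma Rintegral_law (f : pathT R I -> R) : L1 P (f \o path_of) ->
  measurable_fun setT f ->
  L1 law f /\ \int[law]_x f x = \int[P]_w f (path_of w).
Proof.
move=> fi mf; have mf' : measurable_fun setT (EFin \o f) by exact/measurable_EFinP.
split.
  by apply: (integrable_pushforward measurable_path_of).
rewrite /Rintegral; congr fine.
by rewrite (integral_pushforward measurable_path_of).
Qed.

End stationary_process.

(** * Vanishing conditional mean *)

Section conditional_mean_zero.
Import HBNNSimple.
Context {R : realType} {d} {Om : measurableType d} (P : {measure set Om -> \bar R}).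
Variable G : set (set Om).
Hypothesis mG : G `<=` measurable.
Variable u : Om -> R.
Hypothesis ui : L1 P u.
Hypothesis u0 : forall A, <<s G >> A -> (\int[P]_(w in A) (u w)%:E = 0)%E.

Lemma sub_sigma_measurable A : <<s G >> A -> measurable A.
Proof.
apply: smallest_sub => //; exact: sigma_algebra_measurable.
Qed.

Lemma sub_measurable_fun (W : g_sigma_algebraType G -> R) :
  measurable_fun setT W -> measurable_fun setT (W : Om -> R).
Proof.
move=> mW _ B mB; apply: sub_sigma_measurable; exact: mW.
Qed.

Lemma mean0_indic A : <<s G >> A ->
  L1 P (fun w => \1_A w * u w) /\ \int[P]_w (\1_A w * u w) = 0.
Proof.
move=> AG; have mA := sub_sigma_measurable AG.
have -> : (fun w => \1_A w * u w) = u \_ A.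
  by rewrite patch_indic; apply/funext => w /=; rewrite mulrC.
split.
  rewrite /L1 -restrict_EFin.
  exact: ((integrable_mkcond _ mA).1 (integrableS measurableT mA (@subsetT _ _) ui)).
by rewrite -Rintegral_mkcond /Rintegral u0.
Qed.

Lemma mean0_indic_sum (s : seq R) (A : R -> set Om) (f : Om -> R) :
  (forall y, <<s G >> (A y)) ->
  (forall w, f w = \sum_(y <- s) y * \1_(A y) w) ->
  L1 P (fun w => f w * u w) /\ \int[P]_w (f w * u w) = 0.
Proof.
move=> AG; elim: s f => [|y s IH] f fE.
  have -> : (fun w => f w * u w) = cst 0.
    by apply/funext => w; rewrite fE big_nil mul0r.
  by split; [exact: integrable0|rewrite Rintegral_cst// mul0r].
have [ys ys0] := mean0_indic (AG y).
have [ss ss0] := IH _ (fun=> erefl).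
have -> : (fun w => f w * u w) = (fun w => y * (\1_(A y) w * u w)
    + (\sum_(y <- s) y * \1_(A y) w) * u w).
  by apply/funext => w; rewrite fE big_cons; ring.
split; first by apply: L1D => //; exact: L1Z.
rewrite RintegralD//; last exact: L1Z.
by rewrite RintegralZl// ys0 ss0 mulr0 addr0.
Qed.

(** The simple functions approximating [W] have level sets in the sigma-algebra generated by [G], so
    their products with [u] have mean zero. Dominated convergence, with bound the absolute value of
    [W w * u w], passes to the limit. *)
Lemma mean0_mul_ge0 (W : g_sigma_algebraType G -> R) :
  measurable_fun setT W -> (forall w, 0 <= W w) ->
  L1 P (fun w => W w * u w) -> \int[P]_w (W w * u w) = 0.
Proof.
move=> mW W0 Wu.
have mW' : measurable_fun setT (EFin \o W) by exact/measurable_EFinP.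
pose phi := nnsfun_approx measurableT mW'.
have phiW n w : 0 <= phi n w <= W w.
  rewrite fun_ge0/= /phi nnsfun_approxE -lee_fin.
  by apply: le_approx => // x _; rewrite lee_fin.
have phi0 n : L1 P (fun w => phi n w * u w) /\ \int[P]_w (phi n w * u w) = 0.
  have Aphi y : <<s G >> (phi n @^-1` [set y]) by exact: (measurable_funPTI (phi n)).
  have phiE w : phi n w = \sum_(y <- finmap.enum_fset (fset_set (range (phi n))))
      y * \1_(phi n @^-1` [set y]) w.
    by rewrite [LHS]fimfunE fsbig_finite.
  exact: mean0_indic_sum Aphi phiE.
have mEF h : L1 P h -> measurable_fun setT (fun x => (h x)%:E).
  by move=> hi'; exact: measurable_int hi'.
have [||| _ _ cvgI] := @dominated_convergence _ _ _ P setT measurableT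
  (fun n w => (phi n w * u w)%:E) (fun w => (W w * u w)%:E)
  (fun w => `|(W w * u w)%:E|%E) (fun n => mEF _ (phi0 n).1) (mEF _ Wu).
- apply: aeW => w _; apply: cvg_EFin; first exact: nearW.
  have W0' x : setT x -> (0 <= (EFin \o W) x)%E by move=> _; rewrite lee_fin.
  have /fine_cvgP[_ h] := cvg_nnsfun_approx measurableT mW' W0' (x := w) I.
  by apply: cvgM h _; exact: cvg_cst.
- exact: integrable_abse Wu.
- apply: aeW => w n _; rewrite lee_fin !normrM ler_wpM2r//.
  by have /andP[p0 pW] := phiW n w; rewrite !ger0_norm// (le_trans p0).
have cvg0 : (fun=> 0%E : \bar R) @ \oo --> (\int[P]_w (W w * u w)%:E)%E.
  apply: cvg_trans cvgI; apply: near_eq_cvg; apply: nearW => n.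
  have [fi] := phi0 n; rewrite /Rintegral => fi0.
  by have /= := fineK (integrable_fin_num measurableT fi); rewrite fi0 => <-.
have cst0 : (fun=> 0%E : \bar R) @ \oo --> (0%E : \bar R) by exact: cvg_cst.
by rewrite /Rintegral (cvg_unique (@ereal_hausdorff R) cvg0 cst0).
Qed.

(** The positive and negative parts of [W] are bounded by its absolute value, so their products with
    [u] remain integrable and the nonnegative case applies to each. *)
Lemma mean0_mul (W : g_sigma_algebraType G -> R) :
  measurable_fun setT W ->
  L1 P (fun w => W w * u w) -> \int[P]_w (W w * u w) = 0.
Proof.
move=> mW Wu; have mW' := sub_measurable_fun mW.
have aux (V : g_sigma_algebraType G -> R) : measurable_fun setT V ->
    (forall w, 0 <= V w <= `|W w|) ->
    L1 P (fun w => V w * u w) /\ \int[P]_w (V w * u w) = 0.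
  move=> mV VW; have VuL1 : L1 P (fun w => V w * u w).
    apply: (L1_dom _ (integrable_norm Wu)).
      by apply: measurable_funM; [exact: sub_measurable_fun|exact: L1_measurable ui].
    move=> w; rewrite /= !normrM ler_wpM2r//.
    by have /andP[V0 VW'] := VW w; rewrite ger0_norm.
  by split => //; apply: mean0_mul_ge0 => // w; case/andP: (VW w).
have [p1 p2] : L1 P (fun w => Num.max (W w) 0 * u w) /\
    \int[P]_w (Num.max (W w) 0 * u w) = 0.
  apply: aux => [|w]; first by apply: measurable_maxr => //.
  by rewrite le_max lexx orbT ge_max normr_ge0 ler_norm.
have [n1 n2] : L1 P (fun w => Num.max (- W w) 0 * u w) /\
    \int[P]_w (Num.max (- W w) 0 * u w) = 0.
  apply: aux => [|w]; first by apply: measurable_maxr => //; exact: measurable_funN.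
  by rewrite le_max lexx orbT ge_max normr_ge0 -normrN ler_norm.
have -> : (fun w => W w * u w) =
    (fun w => Num.max (W w) 0 * u w - Num.max (- W w) 0 * u w).
  apply/funext => w; rewrite -mulrBl; congr (_ * _).
  by case: (leP (W w) 0) => W0; case: (leP (- W w) 0) => W1; lra.
by rewrite RintegralB// p2 n2 subrr.
Qed.

End conditional_mean_zero.

(** * Positive definite matrices *)

Section positive_definite.
Context {R : rcfType} {p : nat}.
Implicit Types (x y h : 'cV[R]_p) (M A : 'M[R]_p).

Definition sqn (x : 'cV[R]_p) : R := \sum_i x i 0 ^+ 2.

Lemma sqn_ge0 x : 0 <= sqn x.
Proof. by apply: sumr_ge0 => i _; exact: sqr_ge0. Qed.

Lemma sqnE x : (x^T *m x) 0 0 = sqn x.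
Proof. by rewrite mxE; apply: eq_bigr => i _; rewrite mxE expr2. Qed.

Lemma coord_le_sqn x i : x i 0 ^+ 2 <= sqn x.
Proof.
rewrite /sqn (bigD1 i)//= lerDl; apply: sumr_ge0 => j _; exact: sqr_ge0.
Qed.

Lemma enorm_sqn x : enorm x ^+ 2 = sqn x.
Proof. by rewrite sqr_sqrtr//; exact: sqn_ge0. Qed.

Lemma coord_le_enorm x i : `|x i 0| <= enorm x.
Proof. by rewrite -sqrtr_sqr ler_wsqrtr//; exact: coord_le_sqn. Qed.

Lemma normM_coord_le_sqn x i j : `|x i 0 * x j 0| <= sqn x.
Proof.
have := coord_le_sqn x i; have := coord_le_sqn x j => xj xi.
by rewrite ler_norml; apply/andP; split; nra.
Qed.

Lemma quadE M x : (x^T *m M *m x) 0 0 = \sum_i \sum_j x i 0 * x j 0 * M i j.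
Proof.
rewrite mxE exchange_big; apply: eq_bigr => j _; rewrite mxE mulr_suml.
by apply: eq_bigr => i _; rewrite mxE; ring.
Qed.

Lemma quad_norm_le M x b : (forall i j, `|M i j| <= b) ->
  `|(x^T *m M *m x) 0 0| <= (p * p)%:R * b * sqn x.
Proof.
move=> Mb; rewrite quadE.
have -> : (p * p)%:R * b * sqn x = \sum_(i < p) \sum_(j < p) (sqn x * b).
  by rewrite !sumr_const !card_ord -mulrnA -[RHS]mulr_natl; ring.
apply: le_trans (ler_norm_sum _ _ _) _; apply: ler_sum => i _.
apply: le_trans (ler_norm_sum _ _ _) _; apply: ler_sum => j _.
by rewrite normrM ler_pM ?normM_coord_le_sqn.
Qed.

Lemma posdef_unitmx M : posdef M -> M \in unitmx.
Proof.
move=> Mpd; rewrite -row_free_unit; apply: inj_row_free => v vM.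
apply/eqP; apply: contraT => v0.
have : v^T != 0 by rewrite -trmx0 (inj_eq (@trmx_inj _ _ _)).
by move=> /Mpd; rewrite trmxK vM mul0mx mxE ltxx.
Qed.

(* Expand [q (x - s y) >= 0] for the form [q] of [M], with [M y = x]
   and [s] small compared with the entries of the inverse of [M]. *)
Lemma posdef_lower_bound M : M^T = M -> posdef M ->
  exists c : R, 0 < c /\ forall x, c * sqn x <= (x^T *m M *m x) 0 0.
Proof.
move=> Msym Mpd; have Mu := posdef_unitmx Mpd.
pose b := \sum_i \sum_j `|invmx M i j|.
have Nb i j : `|invmx M i j| <= b.
  rewrite /b (bigD1 i)//= (bigD1 j)//= -addrA lerDl addr_ge0//.
    by apply: sumr_ge0.
  by apply: sumr_ge0 => k _; apply: sumr_ge0.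
have b0 : 0 <= b by apply: sumr_ge0 => k _; apply: sumr_ge0.
pose C : R := (p * p)%:R * b; have C0 : 0 <= C by rewrite mulr_ge0.
(* [C] bounds the form of the inverse. With [s * C <= 1] the second-order term of the expansion
   costs at most [s * sqn x] of the gain [2 * s * sqn x], so [s] itself serves as the lower
   bound. *)
pose s := (C + 1)^-1; have s0 : 0 < s by rewrite invr_gt0; lra.
have sC : s * C <= 1.
  by rewrite mulrC ler_pdivrMr; lra.
exists s; split => // x; pose y := invmx M *m x.
have My : M *m y = x by rewrite mulKVmx.
have yM : y^T *m M = x^T by rewrite -{1}Msym -trmx_mul My.
have yxE : (y^T *m x) 0 0 = (x^T *m invmx M *m x) 0 0.
  rewrite /y trmx_mul trmx_inv Msym; by [].
have yx : (y^T *m x) 0 0 <= C * sqn x.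
  by rewrite yxE; apply: le_trans (ler_norm _) _; exact: quad_norm_le.
have : 0 <= ((x - s *: y)^T *m M *m (x - s *: y)) 0 0.
  have [->|xy] := eqVneq (x - s *: y) 0; first by rewrite mulmx0 mxE.
  exact: ltW (Mpd _ xy).
have -> : ((x - s *: y)^T *m M *m (x - s *: y)) 0 0 =
    (x^T *m M *m x) 0 0 - 2 * s * sqn x + s ^+ 2 * (y^T *m x) 0 0.
  have -> : (x - s *: y)^T = x^T - s *: y^T by rewrite linearB linearZ.
  rewrite -sqnE !mulmxBl !mulmxBr -!scalemxAr -!scalemxAl.
  rewrite yM -[x^T *m M *m y]mulmxA My.
  have -> : x^T *m y = y^T *m x.
    apply/matrixP => i j; rewrite !ord1 !mxE.
    by apply: eq_bigr => k _; rewrite !mxE mulrC.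
  rewrite !mxE; ring.
have a0 := sqn_ge0 x; have h1 : s * C * (s * sqn x) <= s * sqn x.
  by rewrite ler_piMl// mulr_ge0// ltW.
have : s ^+ 2 * (y^T *m x) 0 0 <= s ^+ 2 * (C * sqn x).
  by rewrite ler_wpM2l// sqr_ge0.
nra.
Qed.

End positive_definite.

(** * Least squares for intervals *)

Section kernel_form.
Context {R : rcfType} (k11 k12 k22 : R).
Local Notation ip := (ipK k11 k12 k22).

Lemma ipKE (A B : ivl R) : ip A B =
  k11 * A.2 * B.2 - k12 * A.2 * B.1 - k12 * A.1 * B.2 + k22 * A.1 * B.1.
Proof. by rewrite /ipK !big_bool /kern /supp /iL /iR /=; ring. Qed.

Lemma ipKC (A B : ivl R) : ip A B = ip B A.
Proof. by rewrite !ipKE; ring. Qed.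

Lemma ipK_suml (I : finType) (h : I -> R) (F : I -> ivl R) (B : ivl R) :
  ip (\sum_i h i * (F i).1, \sum_i h i * (F i).2) B = \sum_i h i * ip (F i) B.
Proof.
rewrite ipKE /= !mulr_sumr !mulr_suml -!sumrN -!big_split /=.
by apply: eq_bigr => i _; rewrite ipKE; ring.
Qed.

Hypotheses (k11_gt0 : 0 < k11) (k_det : k12 ^+ 2 < k11 * k22).

(** The constant is determinant over trace. The trace times the form at [(a, b)], minus the
    determinant times [a ^+ 2 + b ^+ 2], is the sum of the squares of [k11 * b - k12 * a] and
    [k22 * a - k12 * b]. *)
Lemma ipK_lower_bound : exists c : R, 0 < c /\
  forall A, c * (A.1 ^+ 2 + A.2 ^+ 2) <= ip A A.
Proof.
have k22_gt0 : 0 < k22.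
  by rewrite -(pmulr_rgt0 _ k11_gt0) (le_lt_trans _ k_det)// sqr_ge0.
have s0 : 0 < k11 + k22 by rewrite addr_gt0.
exists ((k11 * k22 - k12 ^+ 2) / (k11 + k22)); split.
  by rewrite divr_gt0// subr_gt0.
move=> [a b]; rewrite ipKE /= mulrAC ler_pdivrMr//.
have := sqr_ge0 (k11 * b - k12 * a); have := sqr_ge0 (k22 * a - k12 * b).
nra.
Qed.

Lemma ipK_ge0 A : 0 <= ip A A.
Proof.
have [c [c0 cA]] := ipK_lower_bound; apply: le_trans (cA A).
by rewrite mulr_ge0 ?addr_ge0 ?sqr_ge0// ltW.
Qed.

Lemma normK_sqr A : normK k11 k12 k22 A ^+ 2 = ip A A.
Proof. by rewrite sqr_sqrtr// ipK_ge0. Qed.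

End kernel_form.

Section least_squares.
Context {R : rcfType} (k11 k12 k22 : R) (q s J : nat).
Variables (Y : int -> ivl R) (X : 'I_J -> int -> ivl R).
Local Notation p := (dimp q s J).
Local Notation ip := (ipK k11 k12 k22).
Local Notation Z := (Zcomp q s J Y X).
Hypotheses (k11_gt0 : 0 < k11) (k_det : k12 ^+ 2 < k11 * k22).

Definition gram (n : nat) : 'M[R]_p :=
  \matrix_(i, j) \sum_(1 <= t < n.+1) ip (Z t i) (Z t j).

Definition score (n : nat) (th : 'cV[R]_p) (i : 'I_p) : R :=
  \sum_(1 <= t < n.+1) ip (Z t i) (resid q s J Y X t th).

(** The residual is affine in the parameter: moving from [th0] to [th] subtracts the combination of
    the regressors with coefficients [h]. The identity is the expansion of the form. *)
Lemma ipK_resid (t : int) (th0 th : 'cV[R]_p) :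
  let h := th - th0 in
  ip (resid q s J Y X t th) (resid q s J Y X t th) =
  ip (resid q s J Y X t th0) (resid q s J Y X t th0)
  - 2 * (\sum_i h i 0 * ip (Z t i) (resid q s J Y X t th0))
  + \sum_i \sum_j h i 0 * h j 0 * ip (Z t i) (Z t j).
Proof.
move=> h; set u := resid q s J Y X t th0.
pose a := \sum_i h i 0 * (Z t i).1; pose b := \sum_i h i 0 * (Z t i).2.
have -> : resid q s J Y X t th = (u.1 - a, u.2 - b).
  rewrite /u /resid /isub /Zlin /iL /iR /a /b /=; congr pair;
    rewrite -addrA -opprD -big_split/=; congr (_ - _); apply: eq_bigr => i _;
    by rewrite !mxE /Zcomp; ring.
rewrite -ipK_suml -/a -/b.
have -> : \sum_i \sum_j h i 0 * h j 0 * ip (Z t i) (Z t j) = ip (a, b) (a, b).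
  rewrite {1}/a {1}/b ipK_suml; apply: eq_bigr => i _.
  rewrite ipKC /a /b ipK_suml mulr_sumr; apply: eq_bigr => j _.
  by rewrite ipKC mulrA.
by rewrite !ipKE /=; ring.
Qed.

Lemma QK_expand n (th0 th : 'cV[R]_p) :
  let h := th - th0 in
  QK k11 k12 k22 q s J Y X n th = QK k11 k12 k22 q s J Y X n th0
  - 2 * (\sum_i h i 0 * score n th0 i) + (h^T *m gram n *m h) 0 0.
Proof.
move=> h; rewrite /QK.
under eq_bigr do rewrite normK_sqr// (ipK_resid _ th0).
rewrite !big_split /= -/h; under [in RHS]eq_bigr do rewrite normK_sqr//.
congr (_ + _ + _).
  rewrite sumrN -mulr_sumr; congr (- (_ * _)); rewrite exchange_big.
  by apply: eq_bigr => i _; rewrite -mulr_sumr.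
rewrite quadE exchange_big; apply: eq_bigr => i _.
by rewrite exchange_big; apply: eq_bigr => j _; rewrite [gram _ _ _]mxE mulr_sumr.
Qed.

Lemma normr_sum_coord_le (h : 'cV[R]_p) : \sum_i `|h i 0| <= p%:R * enorm h.
Proof.
rewrite mulr_natl -[X in _ *+ X](card_ord p) -sumr_const; apply: ler_sum => i _.
exact: coord_le_enorm.
Qed.

(** With r the root of n and e the norm of the error, the expansion gives [r ^+ 2 * c * e ^+ 2 <= (2
    * K * r + L) * (p%:R * e)], which is divided by [r * e * c]. The unpenalized estimator has
    [L = 0]; for the penalized one [L] comes from the weights. *)
Lemma least_squares_bound n (th0 th : 'cV[R]_p) (c K L : R) :
  (0 < n)%N -> 0 < c -> 0 <= K -> 0 <= L ->
  (forall h : 'cV[R]_p, n%:R * c * sqn h <= (h^T *m gram n *m h) 0 0) ->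
  (forall i, `|score n th0 i| <= K * Num.sqrt n%:R) ->
  QK k11 k12 k22 q s J Y X n th <= QK k11 k12 k22 q s J Y X n th0
    + L * \sum_i `|(th - th0) i 0| ->
  Num.sqrt n%:R * enorm (th - th0) <= p%:R * (2 * K + L / Num.sqrt n%:R) / c.
Proof.
move=> n0 c0 K0 L0 gramc scoreK; rewrite (QK_expand n th0); set h := th - th0.
move=> Qh; set r := Num.sqrt n%:R; set e := enorm h.
have r0 : 0 < r by rewrite sqrtr_gt0 ltr0n.
have r2 : r ^+ 2 = n%:R by rewrite sqr_sqrtr// ler0n.
have e0 : 0 <= e by exact: sqrtr_ge0.
have sc : \sum_i h i 0 * score n th0 i <= K * r * \sum_i `|h i 0|.
  rewrite mulr_sumr; apply: ler_sum => i _; apply: le_trans (ler_norm _) _.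
  by rewrite normrM mulrC ler_wpM2r// scoreK.
have gh := gramc h; rewrite -enorm_sqn -/e -r2 in gh.
have hS := normr_sum_coord_le h; rewrite -/e in hS.
have key : r ^+ 2 * c * e ^+ 2 <= (2 * K * r + L) * (p%:R * e).
  apply: (@le_trans _ _ ((2 * K * r + L) * \sum_i `|h i 0|)); first by nra.
  by rewrite ler_wpM2l// addr_ge0// !mulr_ge0// ltW.
have [->|en0] := eqVneq e 0.
  by rewrite mulr0 divr_ge0 ?(ltW c0)// mulr_ge0// addr_ge0 ?mulr_ge0 ?invr_ge0 ?(ltW r0).
have {}e0 : 0 < e by rewrite lt_neqAle eq_sym en0.
rewrite ler_pdivlMr//.
rewrite -(ler_pM2r (mulr_gt0 r0 e0)).
have -> : p%:R * (2 * K + L / r) * (r * e) = (2 * K * r + L) * (p%:R * e).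
  by field; rewrite lt0r_neq0.
by apply: le_trans key; rewrite le_eqVlt; apply/orP; left; apply/eqP; ring.
Qed.

End least_squares.

(** * The regressors as functions of the path *)

Section regressors.
Context {R : fieldType} (q s J : nat).

(** The alternative, the covariate and the lag depend on the position only, uniformly in [X] and
    [t]. The first case is the default value past the end of the list. *)
Lemma nth_lagged_covariates (r : seq nat) n :
  (forall (X : 'I_J -> int -> ivl R) t,
     nth (0, 0) (flatten [seq [seq X j (t - i%:Z) | j <- enum 'I_J] | i <- r]) n
     = (0, 0)) \/
  (exists j k, forall (X : 'I_J -> int -> ivl R) t,
     nth (0, 0) (flatten [seq [seq X j (t - i%:Z) | j <- enum 'I_J] | i <- r]) n
     = X j (t - k%:Z)).
Proof.
elim: r n => [|k r IH] n; first by left => X t; rewrite nth_nil.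
have [nJ|Jn] := ltnP n J.
  right; exists (Ordinal nJ), k => X t /=.
  rewrite nth_cat size_map size_enum_ord nJ.
  by rewrite (nth_map (Ordinal nJ)) ?size_enum_ord// (nth_ord_enum _ (Ordinal nJ)).
have [IHn|[j [l IHn]]] := IH (n - J)%N; [left|right; exists j, l] => X t /=;
  by rewrite nth_cat size_map size_enum_ord ltnNge Jn IHn.
Qed.

Lemma nth_Zseq n :
  [\/ exists A, forall (Y : int -> ivl R) (X : 'I_J -> int -> ivl R) t,
        nth (0, 0) (Zseq q s J Y X t) n = A,
      exists k : nat, forall (Y : int -> ivl R) (X : 'I_J -> int -> ivl R) t,
        nth (0, 0) (Zseq q s J Y X t) n = Y (t - k.+1%:Z) |
      exists j (k : nat), forall (Y : int -> ivl R) (X : 'I_J -> int -> ivl R) t,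
        nth (0, 0) (Zseq q s J Y X t) n = X j (t - k%:Z)].
Proof.
case: n => [|[|n]].
- by apply: Or31; exists (1, 1).
- by apply: Or31; exists (- (1 / 2), 1 / 2).
have [nq|qn] := ltnP n q.
  apply: Or32; exists n => Y X t.
  by rewrite /Zseq /= nth_cat size_map size_iota nq (nth_map 0%N) ?size_iota// nth_iota.
have E (Y : int -> ivl R) (X : 'I_J -> int -> ivl R) t :
    nth (0, 0) (Zseq q s J Y X t) n.+2 = nth (0, 0)
      (flatten [seq [seq X j (t - i%:Z) | j <- enum 'I_J] | i <- iota 0 s.+1]) (n - q).
  by rewrite /Zseq [LHS]/= nth_cat size_map size_iota ltnNge qn.
have [h|[j [k h]]] := nth_lagged_covariates (iota 0 s.+1) (n - q).
  by apply: Or31; exists (0, 0) => Y X t; rewrite E h.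
by apply: Or33; exists j, k => Y X t; rewrite E h.
Qed.

End regressors.

Section random_regressors.
Context {R : fieldType} {Om : Type} (q s J : nat).
Variables (Y : int -> Om -> ivl R) (X : 'I_J -> int -> Om -> ivl R).

(** This induction principle yields moments and measurability alike. The bounds, strict for [Y] and
    large for [X], are those of the information set at time [t - 1]. *)
Lemma Zc_ind (Q : (Om -> R) -> Prop) t (i : 'I_(dimp q s J)) :
  (forall a, Q (fun=> a)) ->
  (forall b r, r < t -> Q (pcoord Y X (inl b) r)) ->
  (forall jb r, r <= t -> Q (pcoord Y X (inr jb) r)) ->
  Q (fun w => (Zc q s J Y X t i w).1) /\ Q (fun w => (Zc q s J Y X t i w).2).
Proof.
move=> Qc QY QX; have [[A h]|[k h]|[j [k h]]] := nth_Zseq (R := R) q s J i;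
  have E w := h (Y^~ w) (fun j r => X j r w) t.
- by split; under eq_fun do rewrite /Zc /Zcomp E; exact: Qc.
- have kt : t - k.+1%:Z < t by rewrite ltrBlDr ltrDl.
  split; under eq_fun do rewrite /Zc /Zcomp E.
    exact: (QY false _ kt).
  exact: (QY true _ kt).
- have kt : t - k%:Z <= t by rewrite lerBlDr lerDl.
  split; under eq_fun do rewrite /Zc /Zcomp E.
    exact: (QX (j, false) _ kt).
  exact: (QX (j, true) _ kt).
Qed.

Lemma ut_ind (Q : (Om -> R) -> Prop) t (th : 'cV[R]_(dimp q s J)) :
  (forall a, Q (fun=> a)) ->
  (forall f g, Q f -> Q g -> Q (fun w => f w + g w)) ->
  (forall a f, Q f -> Q (fun w => a * f w)) ->
  (forall k r, r <= t -> Q (pcoord Y X k r)) ->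
  Q (fun w => (ut q s J Y X t th w).1) /\ Q (fun w => (ut q s J Y X t th w).2).
Proof.
move=> Qc QD QZ Qp.
have Zi i := Zc_ind i Qc (fun b r rt => Qp (inl b) r (ltW rt))
  (fun jb r => Qp (inr jb) r).
have Qsum (F : 'I_(dimp q s J) -> Om -> R) : (forall i, Q (F i)) ->
    Q (fun w => \sum_i th i 0 * F i w).
  move=> QF; elim: (index_enum _) => [|i r IH].
    by under eq_fun do rewrite big_nil; exact: Qc.
  by under eq_fun do rewrite big_cons; apply: QD => //; exact: QZ.
split.
  have := QD _ _ (Qp (inl false) t (lexx _)) (QZ (-1) _ (Qsum _ (fun i => (Zi i).1))).
  by under eq_fun do rewrite mulN1r.
have := QD _ _ (Qp (inl true) t (lexx _)) (QZ (-1) _ (Qsum _ (fun i => (Zi i).2))).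
by under eq_fun do rewrite mulN1r.
Qed.

End random_regressors.

(** * The regression model on path space *)

Section coordinate_process.
Context {R : realType} (q s J : nat).
Local Notation path := (pathT R (cidx J)).

Definition Yc (t : int) (g : path) : ivl R := (g t (inl false), g t (inl true)).
Definition Xc (j : 'I_J) (t : int) (g : path) : ivl R :=
  (g t (inr (j, false)), g t (inr (j, true))).

Lemma pcoord_coord k t g : pcoord Yc Xc k t g = g t k.
Proof. by case: k => [[]|[j []]]. Qed.

Lemma iter_pshift n (g : path) r k : iter n pshift g r k = g (r + n%:Z) k.
Proof.
elim: n r => [|n IH] r; first by rewrite addr0.
by rewrite iterS /pshift IH -addrA -intS.
Qed.

(** Translation in time becomes the shift of the path, so sums over time turn into orbit sums. *)
Lemma Zc_pshift t i n (g : path) :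
  Zc q s J Yc Xc t i (iter n pshift g) = Zc q s J Yc Xc (t + n%:Z) i g.
Proof.
rewrite /Zc /Zcomp; have [[A h]|[k h]|[j [k h]]] := nth_Zseq (R := R) q s J i.
- by rewrite !h.
- by rewrite !h /Yc !iter_pshift addrAC.
- by rewrite !h /Xc !iter_pshift addrAC.
Qed.

Lemma ut_pshift t th n (g : path) :
  ut q s J Yc Xc t th (iter n pshift g) = ut q s J Yc Xc (t + n%:Z) th g.
Proof.
rewrite /ut /resid /isub /Zlin /Yc !iter_pshift; congr (_ - _, _ - _);
  by apply: eq_bigr => i _; have := Zc_pshift t i n g; rewrite /Zc /Zcomp => ->.
Qed.

Context {Om : Type} (Y : int -> Om -> ivl R) (X : 'I_J -> int -> Om -> ivl R).

Lemma Zc_path t i w :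
  Zc q s J Y X t i w = Zc q s J Yc Xc t i (fun r k => pcoord Y X k r w).
Proof.
rewrite /Zc; congr (Zcomp _ _ _ _ _ t i).
  by apply/funext => r; rewrite /Yc /= /iL /iR; case: (Y r w).
by apply/funext => j; apply/funext => r; rewrite /Xc /= /iL /iR; case: (X j r w).
Qed.

Lemma ut_path t th w :
  ut q s J Y X t th w = ut q s J Yc Xc t th (fun r k => pcoord Y X k r w).
Proof.
rewrite /ut; congr (resid _ _ _ _ _ t th).
  by apply/funext => r; rewrite /Yc /= /iL /iR; case: (Y r w).
by apply/funext => j; apply/funext => r; rewrite /Xc /= /iL /iR; case: (X j r w).
Qed.

End coordinate_process.

(** * Score and Gram matrix *)

Lemma measurable_ipK {d} {T : measurableType d} {R : realType} (k11 k12 k22 : R)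
    (A B : T -> ivl R) :
  measurable_fun setT (fun w => (A w).1) -> measurable_fun setT (fun w => (A w).2) ->
  measurable_fun setT (fun w => (B w).1) -> measurable_fun setT (fun w => (B w).2) ->
  measurable_fun setT (fun w => ipK k11 k12 k22 (A w) (B w)).
Proof.
move=> A1 A2 B1 B2; under eq_fun do rewrite ipKE.
apply: measurable_funD; first (apply: measurable_funB; first apply: measurable_funB).
all: by repeat (apply: measurable_funM => //); exact: measurable_cst.
Qed.

Section interval_moments.
Context {R : realType} {d} {Om : measurableType d} (P : probability Om R).
Variables (k11 k12 k22 : R).
Local Notation ip := (ipK k11 k12 k22).

Lemma L2_ipK (A B : Om -> ivl R) :
  L4 P (fun w => (A w).1) -> L4 P (fun w => (A w).2) ->
  L4 P (fun w => (B w).1) -> L4 P (fun w => (B w).2) ->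
  L2 P (fun w => ip (A w) (B w)).
Proof.
move=> A1 A2 B1 B2.
have := L2D (L2D (L2Z k11 (L4M A2 B2)) (L2Z (- k12) (L4M A2 B1)))
  (L2D (L2Z (- k12) (L4M A1 B2)) (L2Z k22 (L4M A1 B1))).
by congr L2; apply/funext => w; rewrite ipKE; ring.
Qed.

Hypotheses (k11_gt0 : 0 < k11) (k_det : k12 ^+ 2 < k11 * k22).

(** The lower bound [c] of the kernel form bounds the fourth power of each endpoint by [c ^- 2]
    times the fourth power of the norm. *)
Lemma L4_normK (A : Om -> ivl R) :
  measurable_fun setT (fun w => (A w).1) -> measurable_fun setT (fun w => (A w).2) ->
  (\int[P]_w (normK k11 k12 k22 (A w) ^+ 4)%:E < +oo)%E ->
  L4 P (fun w => (A w).1) /\ L4 P (fun w => (A w).2).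
Proof.
move=> mA1 mA2 A4; have [c [c0 cA]] := ipK_lower_bound k11_gt0 k_det.
have nE w : normK k11 k12 k22 (A w) ^+ 4 = ip (A w) (A w) ^+ 2.
  by rewrite -(normK_sqr k11_gt0 k_det) -exprM.
have ipi : L1 P (fun w => ip (A w) (A w) ^+ 2).
  apply: L1_ge0 => [|w|]; last by under eq_integral do rewrite -nE.
    by apply: measurable_funX; exact: measurable_ipK.
  exact: sqr_ge0.
have dom (f : Om -> R) : measurable_fun setT f ->
    (forall w, f w ^+ 2 <= (A w).1 ^+ 2 + (A w).2 ^+ 2) -> L4 P f.
  move=> mf fA; split=> //; split; first exact: measurable_funX.
  apply: (L1_dom _ (L1Z (c ^- 2) ipi)); first by do 2 apply: measurable_funX.
  move=> w; rewrite ger0_norm ?sqr_ge0// mulrC ler_pdivlMr ?exprn_gt0//.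
  rewrite -exprMn ler_sqr ?nnegrE ?(mulr_ge0 (sqr_ge0 _) (ltW c0))//; last first.
    by rewrite ipK_ge0.
  apply: le_trans (cA (A w)); rewrite mulrC.
  by rewrite ler_wpM2l// ltW.
split; apply: dom => // w; first by rewrite lerDl sqr_ge0.
by rewrite lerDr sqr_ge0.
Qed.

End interval_moments.

Section interval_regression.
Context {R : realType} {d} {Om : measurableType d} (P : probability Om R).
Variables (k11 k12 k22 : R) (q s J : nat).
Variables (Y : int -> Om -> ivl R) (X : 'I_J -> int -> Om -> ivl R).
Variable theta0 : 'cV[R]_(dimp q s J).
Local Notation ip := (ipK k11 k12 k22).
Local Notation Z := (Zc q s J Y X).
Local Notation u := (ut q s J Y X ^~ theta0).
Hypotheses (k11_gt0 : 0 < k11) (k_det : k12 ^+ 2 < k11 * k22).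
Hypothesis mYX : forall k t, measurable_fun setT (pcoord Y X k t).
Hypothesis Y4 :
  forall t, (\int[P]_w (normK k11 k12 k22 (Y t w) ^+ 4)%:E < +oo)%E.
Hypothesis X4 :
  forall j t, (\int[P]_w (normK k11 k12 k22 (X j t w) ^+ 4)%:E < +oo)%E.

Lemma L4_pcoord k t : L4 P (pcoord Y X k t).
Proof.
have [Y1 Y2] := L4_normK k11_gt0 k_det (mYX (inl false) t) (mYX (inl true) t) (Y4 t).
case: k => [[]|[j b]] //.
have [X1 X2] := L4_normK k11_gt0 k_det (mYX (inr (j, false)) t)
  (mYX (inr (j, true)) t) (X4 j t).
by case: b.
Qed.

Let P_fin : (P setT < +oo)%E.
Proof. by rewrite probability_setT ltry. Qed.

Lemma L4_Z t i : L4 P (fun w => (Z t i w).1) /\ L4 P (fun w => (Z t i w).2).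
Proof.
apply: Zc_ind => [a|b r _|jb r _]; [exact: L4_cst|exact: L4_pcoord..].
Qed.

Lemma L4_u t : L4 P (fun w => (u t w).1) /\ L4 P (fun w => (u t w).2).
Proof.
apply: ut_ind => [a|f g|a f|k r _]; [exact: L4_cst|exact: L4D|exact: L4Z|].
exact: L4_pcoord.
Qed.

Definition xi i t w := ip (Z t i w) (u t w).

Lemma L2_xi i t : L2 P (xi i t).
Proof. by have [? ?] := L4_Z t i; have [? ?] := L4_u t; exact: L2_ipK. Qed.

Lemma L2_ipK_Z i j t : L2 P (fun w => ip (Z t i w) (Z t j w)).
Proof. by have [? ?] := L4_Z t i; have [? ?] := L4_Z t j; exact: L2_ipK. Qed.

(** Naming the generators of [info_prev] makes the information set a measurable structure on [Om],
    so that being known at time [t - 1] is ordinary measurability. *)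
Definition info_gen (t : int) : set (set Om) :=
  [set A | exists (k : cidx J) (r : int) (B : set R),
    measurable B /\ (match k with inl _ => r < t | inr _ => r <= t end)%R /\
    A = (pcoord Y X k r) @^-1` B].

Lemma info_gen_measurable t : info_gen t `<=` measurable.
Proof.
by move=> _ [k [r [B [mB [_ ->]]]]]; rewrite -[X in measurable X]setTI; exact: mYX.
Qed.

Local Notation infoT t := (g_sigma_algebraType (info_gen t)).

Lemma info_pcoord t k r : (match k with inl _ => r < t | inr _ => r <= t end)%R ->
  measurable_fun setT (pcoord Y X k r : infoT t -> R).
Proof.
move=> kt _ B mB; rewrite setTI; apply: sub_sigma_algebra.
by exists k, r, B; split=> //; split=> //; case: k kt.
Qed.

Lemma info_Z t r i : r <= t ->
  measurable_fun setT (fun w : infoT t => (Z r i w).1) /\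
  measurable_fun setT (fun w : infoT t => (Z r i w).2).
Proof.
move=> rt; apply: Zc_ind => [a|b l lr|jb l lr]; first exact: measurable_cst.
  by apply: info_pcoord; exact: lt_le_trans lr rt.
by apply: info_pcoord; exact: le_trans lr rt.
Qed.

Lemma info_u t r : r < t ->
  measurable_fun setT (fun w : infoT t => (u r w).1) /\
  measurable_fun setT (fun w : infoT t => (u r w).2).
Proof.
move=> rt; apply: ut_ind => [a|f g|a f mf|k l lr].
- exact: measurable_cst.
- exact: measurable_funD.
- exact: measurable_funM.
- apply: info_pcoord.
  by case: k => _; [exact: le_lt_trans lr rt|exact: le_trans lr (ltW rt)].
Qed.

Lemma info_xi t r i : r < t -> measurable_fun setT (xi i r : infoT t -> R).
Proof.
move=> rt; have [Z1 Z2] := info_Z i (ltW rt); have [u1 u2] := info_u rt.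
exact: measurable_ipK.
Qed.

Hypothesis u_mean0 : forall (t : int) (v : bool) (A : set Om), info_prev Y X t A ->
  (\int[P]_(w in A) (supp (u t w) v)%:E = 0)%E.

(* The innovation enters [xi] linearly, with coefficients known at time [t - 1]. *)
Lemma xi_orthogonal t i (W : infoT t -> R) :
  measurable_fun setT W -> L2 P (W : Om -> R) ->
  \int[P]_w (W w * xi i t w) = 0.
Proof.
move=> mW W2; have [Z1 Z2] := info_Z i (lexx t).
have [Z41 Z42] := L4_Z t i; have [u41 u42] := L4_u t.
have s4 v : L4 P (fun w => supp (u t w) v).
  by case: v => //; have := L4Z (-1) u41; congr L4; apply/funext => w; rewrite mulN1r.
have term v (a : Om -> R) : L4 P a -> measurable_fun setT (a : infoT t -> R) ->
    L1 P (fun w => W w * a w * supp (u t w) v) /\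
    \int[P]_w (W w * a w * supp (u t w) v) = 0.
  move=> a4 ma; have i1 : L1 P (fun w => W w * a w * supp (u t w) v).
    by have := L2M W2 (L4M a4 (s4 v)); congr L1; apply/funext => w; rewrite mulrA.
  split=> //.
  apply: (@mean0_mul _ _ _ P _ (@info_gen_measurable t) _ _ _ (fun w => W w * a w)) => //.
  - exact: L2_L1 (L4_L2 _ (s4 v)).
  - by move=> A iA; exact: u_mean0.
  - exact: measurable_funM.
have cZ4 (a b : R) (A B : Om -> R) : L4 P A -> L4 P B ->
    L4 P (fun w => a * A w + b * B w).
  by move=> A4 B4; apply: L4D; exact: L4Z.
have cZm (a b : R) (A B : infoT t -> R) : measurable_fun setT A ->
    measurable_fun setT B -> measurable_fun setT (fun w => a * A w + b * B w).
  by move=> mA mB; apply: measurable_funD; exact: measurable_funM.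
(* These are the coefficients of the two values of the support function of the innovation in [xi];
   the minus signs come from the value of the support function of the regressor at -1. *)
have [i1 e1] := term true _ (cZ4 k11 (- k12) _ _ Z42 Z41) (cZm k11 (- k12) _ _ Z2 Z1).
have [i2 e2] := term false _ (cZ4 k12 (- k22) _ _ Z42 Z41) (cZm k12 (- k22) _ _ Z2 Z1).
transitivity (\int[P]_w
    (W w * (k11 * (Z t i w).2 + - k12 * (Z t i w).1) * supp (u t w) true
   + W w * (k12 * (Z t i w).2 + - k22 * (Z t i w).1) * supp (u t w) false)).
  by apply: eq_Rintegral => w _; rewrite /xi ipKE /supp /iL /iR; ring.
by rewrite RintegralD// e1 e2 addr0.
Qed.

Definition score_sum i n w := \sum_(1 <= t < n.+1) xi i t%:Z w.

Lemma score_sumS i n w : score_sum i n.+1 w = score_sum i n w + xi i n.+1%:Z w.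
Proof. by rewrite /score_sum big_nat_recr. Qed.

Lemma L2_score_sum i n : L2 P (score_sum i n).
Proof. by apply: L2_sum => t; exact: L2_xi. Qed.

Lemma info_score_sum i n (t : int) : n%:Z < t ->
  measurable_fun setT (score_sum i n : infoT t -> R).
Proof.
move=> nt; elim: n nt => [|n IH] nt.
  have -> : score_sum i 0 = cst 0 by apply/funext => w; rewrite /score_sum big_geq.
  exact: measurable_cst.
have -> : score_sum i n.+1 = (fun w => score_sum i n w + xi i n.+1%:Z w).
  by apply/funext => w; rewrite score_sumS.
apply: measurable_funD.
  by apply: IH; apply: lt_trans nt; rewrite ltz_nat.
exact: info_xi.
Qed.

Hypothesis stat : strictly_stationary P (pcoord Y X).
Hypothesis erg : ergodic P (pcoord Y X).

Local Notation nu := (law P mYX).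
Local Notation path := (path_of (pcoord Y X)).

Lemma measurable_pcoord_coord k t :
  measurable_fun setT (pcoord (@Yc R J) (@Xc R J) k t : pathT R (cidx J) -> R).
Proof.
have -> : pcoord (@Yc R J) (@Xc R J) k t = (fun g => g t k).
  by apply/funext => g; rewrite pcoord_coord.
exact: measurable_coord.
Qed.

Lemma measurable_Zc_coord t i :
  measurable_fun setT (fun g : pathT R _ => (Zc q s J (@Yc R J) (@Xc R J) t i g).1) /\
  measurable_fun setT (fun g : pathT R _ => (Zc q s J (@Yc R J) (@Xc R J) t i g).2).
Proof.
apply: Zc_ind => [a|b r _|jb r _]; first exact: measurable_cst.
  exact: measurable_pcoord_coord.
exact: measurable_pcoord_coord.
Qed.

Lemma measurable_ut_coord t th :
  measurable_fun setT
    (fun g : pathT R (cidx J) => (ut q s J (@Yc R J) (@Xc R J) t th g).1) /\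
  measurable_fun setT
    (fun g : pathT R (cidx J) => (ut q s J (@Yc R J) (@Xc R J) t th g).2).
Proof.
apply: ut_ind => [a|f g|a f mf|k r _].
- exact: measurable_cst.
- exact: measurable_funD.
- exact: measurable_funM.
- exact: measurable_pcoord_coord.
Qed.

(** On path space the squared increment at time [n.+1] is the one at time 1 composed with [n]
    shifts, and the law is shift invariant. *)
Lemma Rintegral_xi_sqr i n :
  \int[P]_w xi i n.+1%:Z w ^+ 2 = \int[P]_w xi i 1 w ^+ 2.
Proof.
pose F (g : pathT R (cidx J)) := ip (Zc q s J (@Yc R J) (@Xc R J) 1 i g)
  (ut q s J (@Yc R J) (@Xc R J) 1 theta0 g) ^+ 2.
have mF : measurable_fun setT F.
  have [? ?] := measurable_Zc_coord 1 i; have [? ?] := measurable_ut_coord 1 theta0.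
  by apply: measurable_funX; exact: measurable_ipK.
have FE m w : F (iter m pshift (path w)) = xi i (1 + m%:Z) w ^+ 2.
  by rewrite /F Zc_pshift ut_pshift /xi [in RHS]Zc_path [in RHS]ut_path.
have F0 w : F (path w) = xi i 1 w ^+ 2 by rewrite -[path w]/(iter 0 pshift _) FE addr0.
have mit := measurable_iter (@measurable_pshift R (cidx J)) n.
have [|L1F IF] := @Rintegral_law _ _ _ P _ _ mYX F _ mF.
  by have [_] := L2_xi i 1; congr L1; apply/funext => w; rewrite /= F0.
have [|_ IFn] := @Rintegral_law _ _ _ P _ _ mYX (F \o iter n pshift) _
  (measurableT_comp mF mit).
  have [_] := L2_xi i (1 + n%:Z); congr L1; apply/funext => w.
  by rewrite /= FE.
transitivity (\int[nu]_g F (iter n pshift g)).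
  by rewrite IFn; apply: eq_Rintegral => w _; rewrite /= FE -intS.
rewrite (Rintegral_iter (@measurable_pshift R (cidx J))) => [|A mA|//].
  by rewrite IF; apply: eq_Rintegral => w _; rewrite F0.
exact: stationary_pshift.
Qed.

(** The partial sum up to [n] is known before time [n.+1], so the cross term vanishes by
    orthogonality and each step adds the same second moment. *)
Lemma score_variance i n :
  \int[P]_w score_sum i n w ^+ 2 = n%:R * \int[P]_w xi i 1 w ^+ 2.
Proof.
elim: n => [|n IH].
  under eq_Rintegral do rewrite /score_sum big_geq// expr0n.
  by rewrite Rintegral_cst//= !mul0r.
have S2 := L2_score_sum i n; have x2 := L2_xi i n.+1%:Z.
transitivity (\int[P]_w (score_sum i n w ^+ 2 + (2 * (score_sum i n w * xi i n.+1%:Z w)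
    + xi i n.+1%:Z w ^+ 2))).
  by apply: eq_Rintegral => w _; rewrite score_sumS; ring.
have Sx := L2M S2 x2; have [_ Sq] := S2; have [_ xq] := x2.
rewrite RintegralD//; last by apply: L1D => //; exact: L1Z.
rewrite RintegralD//; last exact: L1Z.
rewrite RintegralZl// IH Rintegral_xi_sqr.
rewrite (@xi_orthogonal n.+1%:Z i (score_sum i n)) ?mulr0 ?add0r.
- by rewrite -natr1 mulrDl mul1r.
- by apply: info_score_sum; rewrite ltz_nat.
- exact: S2.
Qed.

(** In Chebyshev's inequality at level [K * Num.sqrt n%:R] the factor [n] of the variance cancels,
    so the bound is uniform in [n]. *)
Lemma score_small i e K n : (0 < n)%N -> 0 < e -> 0 < K ->
  \int[P]_w xi i 1 w ^+ 2 < K ^+ 2 * e ->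
  (P [set w | (K * Num.sqrt n%:R < `|score_sum i n w|)%R] < e%:E)%E.
Proof.
move=> n0 e0 K0 Ke; have r0 : 0 < Num.sqrt n%:R :> R by rewrite sqrtr_gt0 ltr0n.
have := Chebyshev (L2_score_sum i n) (mulr_gt0 K0 r0).
rewrite score_variance exprMn sqr_sqrtr ?ler0n//.
set A := [set w | _] => h.
have {}h : ((K ^+ 2 * n%:R)%:E * P A
    <= (n%:R * \int[P]_w xi i 1 w ^+ 2)%R%:E)%E := h.
have mA : measurable A.
  rewrite -[X in measurable X]setTI; apply: measurable_fun_ltr => //.
  by apply: measurableT_comp => //; case: (L2_score_sum i n).
move: h; rewrite -(fineK (fin_num_measure P A mA)) -EFinM lee_fin lte_fin => h.
have n1 : 0 < n%:R :> R by rewrite ltr0n.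
have K2 : 0 < K ^+ 2 by rewrite exprn_gt0.
rewrite -(ltr_pM2l (mulr_gt0 K2 n1)); apply: le_lt_trans h _.
by rewrite [ltRHS]mulrAC [ltRHS]mulrC ltr_pM2l.
Qed.

(** The law of large numbers for the shift on path space is applied to the product of two regressors
    at time 1, and the exceptional set is pulled back to [Om]. *)
Lemma gram_small i j dl e : 0 < dl -> 0 < e ->
  exists N, forall n, (N <= n)%N ->
    exists B : set Om, measurable B /\
    [set w | n%:R * dl <
      `|gram k11 k12 k22 q s (Y^~ w) (fun j r => X j r w) n i j
        - n%:R * Ex P (fun w => ip (Z 1 i w) (Z 1 j w))|] `<=` B /\
    (P B < e%:E)%E.
Proof.
move=> dl0 e0.
pose F (g : pathT R (cidx J)) := ip (Zc q s J (@Yc R J) (@Xc R J) 1 i g)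
  (Zc q s J (@Yc R J) (@Xc R J) 1 j g).
have mF : measurable_fun setT F.
  have [? ?] := measurable_Zc_coord 1 i; have [? ?] := measurable_Zc_coord 1 j.
  exact: measurable_ipK.
have FE m w : F (iter m pshift (path w)) = ip (Z (1 + m%:Z) i w) (Z (1 + m%:Z) j w).
  by rewrite /F 2!Zc_pshift [Z _ i w]Zc_path [Z _ j w]Zc_path.
have F0 w : F (path w) = ip (Z 1 i w) (Z 1 j w).
  by rewrite -[path w]/(iter 0 pshift _) FE addr0.
have [|L1F IF] := @Rintegral_law _ _ _ P _ _ mYX F _ mF.
  have := L2_L1 P_fin (L2_ipK_Z i j 1); congr L1; apply/funext => w.
  by rewrite /= F0.
have [N HN] := orbit_sum_lln (@measurable_pshift R (cidx J))
  (fun A mA => stationary_pshift mYX stat mA)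
  (fun A mA iA => ergodic_pshift mYX erg mA iA) (law_setT P mYX) L1F dl0 e0.
exists N => n /HN; set S := [set g | _] => Se.
have mS : measurable S.
  rewrite -[X in measurable X]setTI; apply: measurable_fun_ltr => //.
  apply: measurableT_comp => //; apply: measurable_funB => //.
  exact: (measurable_orbit_sum (@measurable_pshift R (cidx J)) n L1F).
exists (path @^-1` S); split; last split=> //.
  by rewrite -[X in measurable X]setTI; exact: measurable_path_of.
(* [F] looks at time 1, so its orbit sum over indices 0 to n - 1 is the Gram sum over times 1 to
   n. *)
move=> w; rewrite /S /= mxE big_add1 big_mkord IF.
have -> : \int[P]_w0 F (path w0) = Ex P (fun w => ip (Z 1 i w) (Z 1 j w)).
  by apply: eq_Rintegral => w0 _; rewrite F0.
by under [in X in _ -> X]eq_bigr do rewrite FE -intS.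
Qed.

End interval_regression.

(** * The penalty *)

Section adaptive_lasso.
Context {R : realType} (k11 k12 k22 : R) (q s J : nat).
Variables (Y : int -> ivl R) (X : 'I_J -> int -> ivl R).
Local Notation p := (dimp q s J).
Local Notation Q := (QK k11 k12 k22 q s J Y X).
Variables (gam lam tau : R) (th0 tl th : 'cV[R]_p) (n : nat).
Hypotheses (gam_gt0 : 0 < gam) (lam_gt0 : 0 < lam) (tau_gt0 : 0 < tau).
Hypothesis th0_tau : forall j, th0 j 0 != 0 -> tau <= `|th0 j 0|.
Hypothesis tl_near : forall j, `|tl j 0 - th0 j 0| <= tau / 2.

(* Only the weights on the support of [th0] enter the comparison with the true
   parameter, and these are bounded since [tl] is close to [th0]. *)
Lemma penalized_le_unpenalized :
  (QKpen k11 k12 k22 q s J Y X n lam gam tl th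
    <= QKpen k11 k12 k22 q s J Y X n lam gam tl th0)%E ->
  Q n th <= Q n th0 + lam * ((tau / 2) `^ gam)^-1 * \sum_i `|(th - th0) i 0|.
Proof.
(* Off the support a zero coordinate of [th0] costs nothing, even under an infinite weight. Hence
   the penalty at [th0] equals the sum weighted by [v], and the penalty at [th] is at least that
   sum. *)
pose v j := if th0 j 0 == 0 then 0 else (`|tl j 0| `^ gam)^-1.
have tl_tau j : th0 j 0 != 0 -> tau / 2 <= `|tl j 0|.
  move=> /th0_tau t0; have := tl_near j; have := ler_distD (tl j 0) (th0 j 0) 0.
  rewrite !subr0 distrC; lra.
have t20 : 0 < tau / 2 by rewrite divr_gt0.
have v0 j : 0 <= v j by rewrite /v; case: ifP => // _; rewrite invr_ge0 powR_ge0.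
have vle j : v j <= ((tau / 2) `^ gam)^-1.
  rewrite /v; case: (eqVneq (th0 j 0) 0) => [_|/tl_tau tj].
    by rewrite invr_ge0 powR_ge0.
  rewrite lef_pV2 ?posrE ?powR_gt0//; last exact: lt_le_trans tj.
  by rewrite ge0_ler_powR ?nnegrE// ltW.
have pen0 j : alpen gam (tl j ord0) (th0 j ord0) = (v j * `|th0 j 0|)%:E.
  rewrite /alpen /v; case: (eqVneq (th0 j 0) 0) => [->|/tl_tau tj].
    by rewrite normr0 !mul0r if_same.
  have -> : (tl j 0 == 0) = false.
    by apply/negbTE; rewrite -normr_gt0 (lt_le_trans t20).
  by rewrite mulrC.
have pen1 j : ((v j * `|th j 0|)%:E <= alpen gam (tl j ord0) (th j ord0))%E.
  rewrite /alpen /v; case: (eqVneq (th0 j 0) 0) => [_|/tl_tau tj].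
    rewrite mul0r; case: ifP => _; first by case: ifP => // _; exact: leey.
    by rewrite lee_fin divr_ge0// powR_ge0.
  have -> : (tl j 0 == 0) = false.
    by apply/negbTE; rewrite -normr_gt0 (lt_le_trans t20).
  by rewrite mulrC.
rewrite /QKpen => Qle.
have : Q n th + lam * (\sum_j v j * `|th j 0|)
    <= Q n th0 + lam * (\sum_j v j * `|th0 j 0|).
  rewrite -lee_fin; move: Qle; under [X in (_ <= _ + _ * X)%E]eq_bigr do rewrite pen0.
  rewrite sumEFin -EFinM -EFinD; apply: le_trans.
  rewrite EFinD leeD2l// EFinM lee_pmul2l ?lte_fin// -sumEFin.
  exact: lee_sum.
have : \sum_j v j * `|th0 j 0| - \sum_j v j * `|th j 0|
    <= ((tau / 2) `^ gam)^-1 * \sum_i `|(th - th0) i 0|.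
  rewrite mulr_sumr -sumrB; apply: ler_sum => j _; rewrite -mulrBr.
  apply: (@le_trans _ _ (v j * `|(th - th0) j 0|)); last by rewrite ler_wpM2r.
  by rewrite ler_wpM2l// !mxE distrC lerB_dist.
rewrite -(ler_pM2l lam_gt0) mulrBr mulrA; lra.
Qed.

End adaptive_lasso.

(** The smallest modulus on the support works; the default 1 covers the zero vector. *)
Lemma support_lower_bound {R : realType} {p : nat} (x : 'cV[R]_p) :
  exists tau : R, 0 < tau /\ forall j, x j 0 != 0 -> tau <= `|x j 0|.
Proof.
exists (\big[Num.min/1]_(j | x j 0 != 0) `|x j 0|); split.
  by apply: lt_bigmin => // j xj; rewrite normr_gt0.
by move=> j xj; exact: bigmin_le_cond.
Qed.

(** * Root-n consistency *)

Section small_probability.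
Context {R : realType} {d} {Om : measurableType d} (P : {measure set Om -> \bar R}).

(** A measurable superset is used because events about the estimators need not be measurable. *)
Definition small (e : R) (A : set Om) : Prop :=
  exists B : set Om, measurable B /\ A `<=` B /\ (P B < e%:E)%E.

Lemma smallU e1 e2 A B : small e1 A -> small e2 B -> small (e1 + e2) (A `|` B).
Proof.
move=> [A' [mA [AA' PA]]] [B' [mB [BB' PB]]]; exists (A' `|` B'); split.
  exact: measurableU.
split; first exact: setUSS.
rewrite EFinD; apply: le_lt_trans (lteD PA PB).
exact: measureU2.
Qed.

Lemma small_sub e A B : A `<=` B -> small e B -> small e A.
Proof.
move=> AB [B' [mB [BB' PB]]]; exists B'; split=> //.
by split=> //; exact: subset_trans BB'.
Qed.

Lemma small_finU (I : finType) e (A : I -> set Om) : 0 < e ->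
  (forall i, small (e / #|I|.+1%:R) (A i)) ->
  small e [set w | exists i, A i w].
Proof.
move=> e0 Ae; have c0 : 0 < e / #|I|.+1%:R by rewrite divr_gt0.
(* The extra share of [e] makes the strict bound hold for the empty list. *)
have : small (e / #|I|.+1%:R * (size (enum I)).+1%:R)
    [set w | exists2 i, i \in enum I & A i w].
  elim: (enum I) => [|i r IH].
    exists set0; split; first exact: measurable0.
    by split; [move=> w []|rewrite measure0 lte_fin mulr1].
  rewrite [size _]/= -(natr1 (size r).+1) mulrDr mulr1 addrC.
  apply: small_sub (smallU (Ae i) IH).
  move=> w /= [j]; rewrite inE => /orP[/eqP ->|jr] Aj; first by left.
  by right; exists j.
rewrite -cardE divfK ?pnatr_eq0//; apply: small_sub => w /= [i Ai].
by exists i => //; rewrite mem_enum.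
Qed.

Lemma small_finU_eventually (I : finType) e (A : I -> nat -> set Om) : 0 < e ->
  (forall i, exists N, forall n, (N <= n)%N -> small (e / #|I|.+1%:R) (A i n)) ->
  exists N, forall n, (N <= n)%N -> small e [set w | exists i, A i n w].
Proof.
move=> e0 /choice[N HN]; exists (\max_i N i) => n Nn.
apply: small_finU => // i; apply: HN; apply: leq_trans Nn.
exact: leq_bigmax.
Qed.

End small_probability.

Unset Implicit Arguments.
Set Strict Implicit.

Theorem theorem1 (R : realType) (d : measure_display) (Om : measurableType d)
  (P : probability Om R)
  (k11 k12 k22 : R) (q s J : nat)
  (Y : int -> Om -> ivl R) (X : 'I_J -> int -> Om -> ivl R)
  (Theta : set 'cV[R]_(dimp q s J)) (theta0 : 'cV[R]_(dimp q s J))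
  (sigma2 : R) (lam : nat -> R) (gam : R)
  (thtl thhat : nat -> Om -> 'cV[R]_(dimp q s J)) :
  (* the kernel K is symmetric positive definite *)
  0 < k11 -> k12 ^+ 2 < k11 * k22 ->
  (* Y and X_j are interval-valued random variables *)
  (forall k t, measurable_fun setT (pcoord Y X k t)) ->
  (* (A1) *)
  strictly_stationary P (pcoord Y X) ->
  ergodic P (pcoord Y X) ->
  (forall t, (\int[P]_w (normK k11 k12 k22 (Y t w) ^+ 4)%:E < +oo)%E) ->
  (forall j t, (\int[P]_w (normK k11 k12 k22 (X j t w) ^+ 4)%:E < +oo)%E) ->
  (forall (t : int) (v : bool) (A : set Om), info_prev Y X t A ->
     (\int[P]_(w in A) (supp (ut q s J Y X t theta0 w) v)%:E = 0)%E) ->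
  (forall (t : int) (A : set Om), info_prev Y X t A ->
     (\int[P]_(w in A) (normK k11 k12 k22 (ut q s J Y X t theta0 w) ^+ 2)%:E
       = sigma2%:E * P A)%E) ->
  (* (A2) *)
  compact Theta -> (interior Theta) theta0 ->
  (* (A3) *)
  (exists delta : R, 0 < delta /\
     forall th : 'cV[R]_(dimp q s J), enorm (th - theta0) < delta ->
     forall t : int,
       posdef (\matrix_(i, j) Ex P (fun w =>
                  ipK k11 k12 k22 (Zc q s J Y X t i w) (Zc q s J Y X t j w)))
       /\
       posdef (\matrix_(i, j) Ex P (fun w =>
                  ipK k11 k12 k22 (Zc q s J Y X t i w) (ut q s J Y X t th w)
                  * ipK k11 k12 k22 (ut q s J Y X t th w) (Zc q s J Y X t j w)))) ->
  (* (A4) and the tuning constants *)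
  0 < gam ->
  (forall n, 0 < lam n) ->
  (fun n : nat => lam n / Num.sqrt n%:R) @ \oo --> 0 ->
  (fun n : nat => lam n * n%:R `^ ((gam - 1) / 2)) @ \oo --> +oo ->
  (* tilde theta_T : minimum D_K-distance estimator over Theta *)
  (forall (n : nat) (w : Om), Theta (thtl n w) /\
     forall th, Theta th ->
       Qn k11 k12 k22 q s J Y X n w (thtl n w) <= Qn k11 k12 k22 q s J Y X n w th) ->
  (* hat theta_T : interval adaptive LASSO estimator over Theta *)
  (forall (n : nat) (w : Om), Theta (thhat n w) /\
     forall th, Theta th ->
       (Qnpen k11 k12 k22 q s J Y X n (lam n) gam w (thtl n w) (thhat n w)
        <= Qnpen k11 k12 k22 q s J Y X n (lam n) gam w (thtl n w) th)%E) ->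
  (* conclusion: || hat theta_T - theta0 || = O_p(1/sqrt T) *)
  forall eps : R, 0 < eps ->
  exists M : R, 0 < M /\
  exists N : nat, forall n : nat, (N <= n)%N ->
    exists B : set Om, measurable B /\
      [set w | M < Num.sqrt n%:R * enorm (thhat n w - theta0)] `<=` B /\
      (P B < eps%:E)%E.
Proof.
move=> k11_gt0 k_det mYX stat erg Y4 X4 u_mean0 _ _ Theta_int [dl0 [dl0_gt0 pd]].
move=> gam_gt0 lam_gt0 lam_cvg _ tl_min th_min eps eps0.
pose p := dimp q s J.
have Theta0 : Theta theta0 by exact: interior_subset Theta_int.
pose G : 'M[R]_p := \matrix_(i, j) Ex P (fun w =>
  ipK k11 k12 k22 (Zc q s J Y X 1 i w) (Zc q s J Y X 1 j w)).
have Gpd : posdef G.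
  have /pd : enorm (theta0 - theta0) < dl0.
    by rewrite subrr /enorm big1 ?sqrtr0// => i _; rewrite mxE expr0n.
  by move=> /(_ 1) [].
have Gsym : G^T = G.
  apply/matrixP => i j; rewrite !mxE; congr (Ex P _).
  by apply/funext => w; rewrite ipKC.
have [c [c0 Gc]] := posdef_lower_bound Gsym Gpd.
have p0 : 0 < (p * p)%:R :> R by rewrite ltr0n.
(* An entrywise error [dl] changes the quadratic form by at most [c / 2 * sqn h], so half of the
   lower bound [c] survives. *)
pose dl := c / 2 / (p * p)%:R; have dl_gt0 : 0 < dl by rewrite !divr_gt0.
have [tau [tau0 th0_tau]] := support_lower_bound theta0.
have e20 : 0 < eps / 2 by rewrite divr_gt0.
pose gramw w n := gram k11 k12 k22 q s (Y^~ w) (fun j r => X j r w) n.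
have [N1 gram_ok] : exists N, forall n, (N <= n)%N -> small P (eps / 2)
    [set w | exists ij : 'I_p * 'I_p,
      n%:R * dl < `|gramw w n ij.1 ij.2 - n%:R * G ij.1 ij.2|].
  apply: small_finU_eventually => // -[i j].
  have e3 : 0 < eps / 2 / #|{: 'I_p * 'I_p}|.+1%:R by rewrite divr_gt0.
  have [N HN] := gram_small k11_gt0 k_det mYX Y4 X4 stat erg i j dl_gt0 e3.
  by exists N => n /HN; rewrite /G mxE.
pose e4 := eps / 2 / #|'I_p|.+1%:R; have e40 : 0 < e4 by rewrite divr_gt0.
pose V i := \int[P]_w xi k11 k12 k22 Y X theta0 i 1 w ^+ 2.
have V0 i : 0 <= V i by apply: Rintegral_ge0 => w _; exact: sqr_ge0.
(* [K] exceeds every [V i / e4] and is at least 1, hence so does [K ^+ 2], as Chebyshev's inequality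
   requires for all coordinates at once. *)
pose K := 1 + \sum_i V i / e4.
have V4 i : 0 <= V i / e4 by rewrite divr_ge0// ltW.
have K1 : 1 <= K by rewrite lerDl; apply: sumr_ge0.
have VK i : V i < K ^+ 2 * e4.
  rewrite -ltr_pdivrMr//; apply: (@lt_le_trans _ _ K).
    rewrite /K (bigD1 i)//=.
    have : 0 <= \sum_(j < p | j != i) V j / e4 by apply: sumr_ge0.
    lra.
  by rewrite expr2 ler_peMr// (le_trans _ K1).
have K0 : 0 < K by exact: lt_le_trans K1.
pose sc i n := score_sum k11 k12 k22 Y X theta0 i n.
have msc i n : measurable_fun setT (sc i n).
  by case: (L2_score_sum theta0 k11_gt0 k_det mYX Y4 X4 i n).
have score_ok n : (0 < n)%N -> small P (eps / 2)
    [set w | exists i, K * Num.sqrt n%:R < `|sc i n w|].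
  move=> n0; apply: small_finU => // i.
  exists [set w | K * Num.sqrt n%:R < `|sc i n w|]; split.
    rewrite -[X in measurable X]setTI; apply: measurable_fun_ltr => //.
    exact: measurableT_comp.
  split=> //.
  exact: (score_small k11_gt0 k_det mYX Y4 X4 u_mean0 stat n0 e40 K0 (VK i)).
(* [Gm] bounds the weights on the support once the first-stage estimator is within [tau / 2] of
   [theta0]. [D] and [M1] are the least squares bounds without penalty and with
   [lam n / Num.sqrt n%:R <= 1]. *)
pose Gm := ((tau / 2) `^ gam)^-1; have Gm0 : 0 <= Gm by rewrite invr_ge0 powR_ge0.
pose M1 := p%:R * (2 * K + Gm) / (c / 2).
pose D := p%:R * (2 * K) / (c / 2).
have [N2 lam_ok] : exists N, forall n, (N <= n)%N -> lam n / Num.sqrt n%:R <= 1.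
  have /cvgrPdist_lt /(_ 1 ltr01) [N _ HN] := lam_cvg.
  exists N => n /HN /=; rewrite sub0r normrN => h.
  by apply: ltW; apply: le_lt_trans h; exact: ler_norm.
have [N3 D_ok] : exists N, forall n, (N <= n)%N -> D <= Num.sqrt n%:R * (tau / 2).
  exists (Num.bound ((D / (tau / 2)) ^+ 2)) => n Nn.
  rewrite -ler_pdivrMr ?divr_gt0//; apply: le_trans (ler_norm _) _.
  rewrite -sqrtr_sqr ler_wsqrtr//; apply: le_trans (ltW (archi_boundP _)) _.
    exact: sqr_ge0.
  by rewrite ler_nat.
exists (M1 + 1); split.
  rewrite ltr_wpDl// /M1 divr_ge0 ?divr_ge0 ?(ltW c0)// mulr_ge0// addr_ge0//.
  by rewrite mulr_ge0// ltW.
exists (maxn 1 (maxn N1 (maxn N2 N3))) => n.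
rewrite !geq_max => /and4P[n1 nN1 nN2 nN3].
have := smallU (gram_ok n nN1) (score_ok n n1); rewrite -splitr.
(* From here [w] lies outside both exceptional events, and the argument is deterministic. *)
apply: small_sub => w /= Mw; apply: contrapT => /not_orP[/forallNP gr /forallNP sco].
have r0 : 0 < Num.sqrt n%:R :> R by rewrite sqrtr_gt0 ltr0n.
have n0 : 0 < n%:R :> R by rewrite ltr0n.
have gramc h : n%:R * (c / 2) * sqn h <= (h^T *m gramw w n *m h) 0 0.
  have Gb i j : `|(gramw w n - n%:R *: G) i j| <= n%:R * dl.
    by have /negP := gr (i, j); rewrite -leNgt !mxE.
  have := quad_norm_le h Gb; rewrite mulmxBr mulmxBl -scalemxAr -scalemxAl.
  have -> : (p * p)%:R * (n%:R * dl) = n%:R * (c / 2).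
    by rewrite /dl; field; rewrite lt0r_neq0.
  set a := h^T *m gramw w n *m h; set b := h^T *m G *m h.
  have -> : (a - n%:R *: b) 0 0 = a 0 0 - n%:R * b 0 0 by rewrite !mxE.
  rewrite -normrN => /(le_trans (ler_norm _)).
  have := ler_wpM2l (ltW n0) (Gc h); rewrite -/b; lra.
have scK i : `|score k11 k12 k22 (Y^~ w) (fun j r => X j r w) n theta0 i|
    <= K * Num.sqrt n%:R.
  by have /negP := sco i; rewrite -leNgt.
have c20 : 0 < c / 2 by rewrite divr_gt0.
(* First pass, with [L = 0]: the unpenalized estimator is close enough to [theta0] to control the
   adaptive weights. *)
have tl_bound : Num.sqrt n%:R * enorm (thtl n w - theta0) <= D.
  have := least_squares_bound k11_gt0 k_det (th := thtl n w) n1 c20 (ltW K0)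
    (lexx 0) gramc scK.
  rewrite mul0r addr0 mul0r addr0; apply.
  exact: (tl_min n w).2.
have tl_near j : `|thtl n w j 0 - theta0 j 0| <= tau / 2.
  have := coord_le_enorm (thtl n w - theta0) j; rewrite !mxE => /le_trans; apply.
  by rewrite -(ler_pM2l r0); apply: le_trans tl_bound (D_ok n nN3).
have pen := penalized_le_unpenalized gam_gt0 (lam_gt0 n) tau0 th0_tau tl_near
  ((th_min n w).2 _ Theta0).
have L0 : 0 <= lam n * Gm by rewrite mulr_ge0// ltW.
(* Second pass, with [L = lam n * Gm]: the scaled error is at most [M1], which contradicts [Mw]. *)
have := least_squares_bound k11_gt0 k_det n1 c20 (ltW K0) L0 gramc scK pen.
move=> hb; have : M1 + 1 < M1.
  apply: lt_le_trans Mw _; apply: le_trans hb _.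
  rewrite /M1 ler_pM2r ?invr_gt0// ler_wpM2l// lerD2l.
  by rewrite mulrAC ler_piMl// lam_ok.
by rewrite gtrDl ltr10.
Qed.
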